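(* $\overline{\mathcal{L}}^{\mathrm{Conv}}_\infty=\overline{\mathcal{L}}^{\mathrm{Def}}_\infty$.
   Context: Let $q$ be a prime power, $A=\mathbb{F}_q[\theta]$, $k=\mathbb{F}_q(\theta)$, $|\theta|_\infty=q$, $\mathbb{C}_\infty$ the completion of an algebraic closure of $k_\infty=\mathbb{F}_q((1/\theta))$. Let $v\in A$ be monic irreducible, $|\cdot|_v$ the normalized $v$-adic absolute value, $\mathbb{C}_v$ the completion of an algebraic closure of $k_v$; $\overline{k}$ an algebraic closure of $k$ with fixed embeddings into $\mathbb{C}_\infty$ and $\mathbb{C}_v$ over $k$. With $L_0=1$, $L_i=\prod_{j=1}^i(\theta-\theta^{q^j})$, for $\mathfrak{s}=(s_1,\dots,s_r)\in\mathbb{N}^r$, $\mathrm{Li}^\star_{\mathfrak{s}}(z_1,\dots,z_r)=\sum_{i_1\ge\cdots\ge i_r\ge0}z_1^{q^{i_1}}\cdots z_r^{q^{i_r}}/(L_{i_1}^{s_1}\cdots L_{i_r}^{s_r})$, evaluated $\infty$-adically. Let $\mathbb{D}_{\mathfrak{s},\infty}=\{(z_i)\in\mathbb{C}_\infty^r:|z_1|_\infty<q^{s_1q/(q-1)},|z_i|_\infty\le q^{s_iq/(q-1)}(2\le i\le r)\}$ (where the series converges), $\mathbb{D}^{\mathrm{Conv}}_{\mathfrak{s},v}=\{(z_i)\in\mathbb{C}_v^r:|z_1|_v<1,|z_i|_v\le1(i\ge2)\}$, $\mathbb{D}^{\mathrm{Def}}_{\mathfrak{s},v}=\{(z_i)\in\mathbb{C}_v^r:|z_i|_v\le1\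 \forall i\}$, $\mathbb{D}^{\mathrm{Conv}}_{\mathfrak{s},\overline{k}}=\mathbb{D}_{\mathfrak{s},\infty}\cap\overline{k}^r\cap\mathbb{D}^{\mathrm{Conv}}_{\mathfrak{s},v}$ and $\mathbb{D}^{\mathrm{Def}}_{\mathfrak{s},\overline{k}}=\mathbb{D}_{\mathfrak{s},\infty}\cap\overline{k}^r\cap\mathbb{D}^{\mathrm{Def}}_{\mathfrak{s},v}$. $\overline{\mathcal{L}}^{\mathrm{Conv}}_\infty$ (resp. $\overline{\mathcal{L}}^{\mathrm{Def}}_\infty$) is the $\overline{k}$-subspace of $\mathbb{C}_\infty$ spanned by $1$ and all $\mathrm{Li}^\star_{\mathfrak{s}}(\mathbf{u})$ with $\mathfrak{s}\in\bigcup_{r>0}\mathbb{N}^r$ and $\mathbf{u}\in\mathbb{D}^{\mathrm{Conv}}_{\mathfrak{s},\overline{k}}$ (resp. $\mathbf{u}\in\mathbb{D}^{\mathrm{Def}}_{\mathfrak{s},\overline{k}}$). *)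

(* Defs.v *)
From HB Require Import structures.
From mathcomp Require Import all_boot all_order all_algebra.
From mathcomp Require Import all_classical all_reals all_analysis.
Import Order.TTheory GRing.Theory Num.Theory.
Import numFieldNormedType.Exports.
Set Implicit Arguments.
Unset Strict Implicit.
Unset Printing Implicit Defensive.
Local Open Scope classical_set_scope.
Local Open Scope quotient_scope.
Local Open Scope ring_scope.

Definition is_abs (R : realType) (K : fieldType) (abs : K -> R) : Prop :=
  [/\ forall x, 0 <= abs x,
      forall x, abs x = 0 <-> x = 0,
      {morph abs : x y / x * y} &
      forall x y, abs (x + y) <= Num.max (abs x) (abs y)].

Definition abs_cvg (R : realType) (K : fieldType) (abs : K -> R)
    (u : nat -> K) (l : K) : Prop :=
  (fun n => abs (u n - l)) @ \oo --> (0 : R).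

Definition abs_complete (R : realType) (K : fieldType) (abs : K -> R) : Prop :=
  forall u : nat -> K,
    (forall e : R, 0 < e -> exists N : nat, forall m n : nat,
       (N <= m)%N -> (N <= n)%N -> abs (u m - u n) < e) ->
    exists l : K, abs_cvg abs u l.

Definition is_completion (R : realType) (K L : fieldType)
    (absK : K -> R) (absL : L -> R) (f : {rmorphism K -> L}) : Prop :=
  [/\ is_abs absL, abs_complete absL,
      forall x, absL (f x) = absK x &
      forall (y : L) (e : R), 0 < e -> exists x : K, absL (y - f x) < e].

Definition is_algebraic_closure (K : fieldType) (L : closedFieldType)
    (f : {rmorphism K -> L}) : Prop :=
  forall x : L, algebraicOver f x.

(* [C] is the completion of an algebraic closure [Kbar] of the completion [K]
   of [k]; since [K] is complete, [absKbar] is the unique extension of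
   [absK] to [Kbar]. *)
Definition is_completed_algebraic_closure (R : realType) (k C : fieldType)
    (absk : k -> R) (absC : C -> R) (f : {rmorphism k -> C}) : Prop :=
  exists (K : fieldType) (absK : K -> R) (f1 : {rmorphism k -> K})
         (Kbar : closedFieldType) (absKbar : Kbar -> R)
         (f2 : {rmorphism K -> Kbar}) (f3 : {rmorphism Kbar -> C}),
    [/\ is_completion absk absK f1,
        is_algebraic_closure f2,
        is_abs absKbar /\ (forall x, absKbar (f2 x) = absK x),
        is_completion absKbar absC f3 &
        forall x, f x = f3 (f2 (f1 x))].

Section RationalFunctions.
Variables (R : realType) (F : finFieldType).

(* Extension of a multiplicative [h] from polynomials to quotients; the value
   does not depend on the representative. *)
Definition frac_ext (h : {poly F} -> R) (x : {fraction {poly F}}) : R :=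
  h (frac (repr x)).1 / h (frac (repr x)).2.

Definition abs_infty : {fraction {poly F}} -> R :=
  frac_ext (fun a => if a == 0 then 0 else #|F|%:R ^+ (size a).-1).

(* For [a != 0] and non-constant [v], [v ^+ i %| a] forces [i < size a]. *)
Definition ord_at (v a : {poly F}) : nat :=
  (\max_(i < size a | (v ^+ i %| a)%R) i)%N.

Definition abs_at (v : {poly F}) : {fraction {poly F}} -> R :=
  frac_ext (fun a =>
    if a == 0 then 0 else (#|F|%:R ^- (size v).-1) ^+ ord_at v a).

Definition theta : {fraction {poly F}} := tofrac 'X.

Definition Lfac (i : nat) : {fraction {poly F}} :=
  \prod_(1 <= j < i.+1) (theta - theta ^+ (#|F| ^ j)).

End RationalFunctions.

Section StarPolylogarithms.
Variables (R : realType) (F : finFieldType).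

Section Value.
Variables (C : fieldType) (abs : C -> R)
  (f : {rmorphism {fraction {poly F}} -> C}).

(* The terms with [i_1 < n]. *)
Definition Listar_partial (r : nat) (s : 'I_r -> nat) (z : 'I_r -> C)
    (n : nat) : C :=
  \sum_(i : {ffun 'I_r -> 'I_n}
         | [forall a : 'I_r, forall b : 'I_r, (a <= b)%N ==> (i b <= i a)%N])
     \prod_(j < r) (z j ^+ (#|F| ^ i j) / f (Lfac F (i j)) ^+ s j).

(* Junk value [0] when the series diverges. *)
Definition Listar (r : nat) (s : 'I_r -> nat) (z : 'I_r -> C) : C :=
  xget 0 [set l | abs_cvg abs (Listar_partial s z) l].

(* The first coordinate [z_1] of the mathematical notation has index [0]. *)
Definition D_infty (r : nat) (s : 'I_r -> nat) (z : 'I_r -> C) : Prop :=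
  forall i : 'I_r,
    let bound := #|F|%:R `^ ((s i * #|F|)%:R / (#|F| - 1)%:R) in
    if i == 0%N :> nat then abs (z i) < bound else abs (z i) <= bound.

End Value.

Definition D_conv (C : fieldType) (abs : C -> R) (r : nat) (z : 'I_r -> C)
    : Prop :=
  forall i : 'I_r, if i == 0%N :> nat then abs (z i) < 1 else abs (z i) <= 1.

Definition D_def (C : fieldType) (abs : C -> R) (r : nat) (z : 'I_r -> C)
    : Prop :=
  forall i : 'I_r, abs (z i) <= 1.

Definition span_over (K C : fieldType) (g : {rmorphism K -> C}) (S : set C)
    : set C :=
  [set x | exists (n : nat) (c : 'I_n -> K) (y : 'I_n -> C),
     (forall j, S (y j)) /\ x = \sum_(j < n) g (c j) * y j].

Section Spaces.
Variables (Cinf Cv kbar : fieldType) (absinf : Cinf -> R) (absv : Cv -> R)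
  (f : {rmorphism {fraction {poly F}} -> Cinf})
  (ginf : {rmorphism kbar -> Cinf}) (gv : {rmorphism kbar -> Cv}).

Definition D_conv_kbar (r : nat) (s : 'I_r -> nat) (u : 'I_r -> kbar) : Prop :=
  D_infty absinf s (ginf \o u) /\ D_conv absv (gv \o u).

Definition D_def_kbar (r : nat) (s : 'I_r -> nat) (u : 'I_r -> kbar) : Prop :=
  D_infty absinf s (ginf \o u) /\ D_def absv (gv \o u).

Definition L_space
    (D : forall r : nat, ('I_r -> nat) -> ('I_r -> kbar) -> Prop) : set Cinf :=
  span_over ginf
    [set y | y = 1 \/
       exists (r : nat) (s : 'I_r -> nat) (u : 'I_r -> kbar),
         [/\ (0 < r)%N, forall i, (0 < s i)%N, D r s u &
             y = Listar absinf f s (ginf \o u)]].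

Definition L_conv : set Cinf := L_space D_conv_kbar.
Definition L_def : set Cinf := L_space D_def_kbar.

End Spaces.
End StarPolylogarithms.

(* Main.v *)
Require Import Defs.
From HB Require Import structures.
From mathcomp Require Import all_boot all_order all_algebra.
From mathcomp Require Import all_field ring_quotient generic_quotient.
From mathcomp Require Import all_classical all_reals all_analysis.
Import Order.TTheory GRing.Theory Num.Theory.
Import numFieldNormedType.Exports.
Set Implicit Arguments.
Unset Strict Implicit.
Unset Printing Implicit Defensive.
Local Open Scope classical_set_scope.
Local Open Scope quotient_scope.
Local Open Scope ring_scope.

(** Let W be the span of 1 and the star polylogarithms at points with |z_1|_v < 1.
    Fix s and the arguments after the first, and let T(z) be the class modulo W of
    Li*_s(z, z_2, ..., z_r); by induction on the depth r, W contains all the values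
    of smaller depth at v-integral points.  T is additive and kills the z with
    |z|_v < 1, and by weak approximation every v-integral z is congruent to an
    oo-adically small one, so T factors through the residue field of v.  From
    L_i = L_{i-1} (theta - theta^{q^i}) one gets, modulo smaller depth,
      T(z^q) = sum_j binom(s_1, j) (-1)^j theta^{s_1 - j} T(theta^j z).
    Every residue class x is algebraic over F_q, so x^{q^m} = x and
    theta^{q^m} = theta (mod v) for some m > 0; iterating the formula m times gives
    T(x) = N(theta) T(x) for a polynomial N over F_q of positive degree.  As theta
    is transcendental, N(theta) <> 1, hence T(x) = 0. *)

(** * Ultrametric absolute values and their residue fields *)

Section UltrametricAbs.
Variables (R : realType) (K : fieldType) (abs : K -> R).
Hypothesis absP : is_abs abs.

Lemma abs_ge0 x : 0 <= abs x. Proof. by case: absP. Qed.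

Lemma absM x y : abs (x * y) = abs x * abs y.
Proof. by case: absP => _ _ ->. Qed.

Lemma abs_max x y : abs (x + y) <= Num.max (abs x) (abs y).
Proof. by case: absP. Qed.

Lemma abs_eq0 x : (abs x == 0) = (x == 0).
Proof. by case: absP => _ h _ _; apply/eqP/eqP => /h. Qed.

Lemma abs0 : abs 0 = 0.
Proof. by apply/eqP; rewrite abs_eq0. Qed.

Lemma abs_gt0 x : (0 < abs x) = (x != 0).
Proof. by rewrite lt_def abs_eq0 abs_ge0 andbT. Qed.

Lemma abs1 : abs 1 = 1.
Proof.
by apply: (mulfI (x := abs 1)); rewrite ?abs_eq0 ?oner_eq0 // -absM !mulr1.
Qed.

Lemma absX x n : abs (x ^+ n) = abs x ^+ n.
Proof. by elim: n => [|n IHn]; rewrite ?abs1 // !exprS absM IHn. Qed.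

(** Serves for the sign [-1] and, in positive characteristic, for the nonzero constants, which are
    all roots of unity. *)
Lemma abs_root1 x n : (0 < n)%N -> x ^+ n = 1 -> abs x = 1.
Proof.
by move=> n0 xn; apply/eqP; rewrite -(@pexpr_eq1 _ _ n) ?abs_ge0 // -absX xn abs1.
Qed.

Lemma absN x : abs (- x) = abs x.
Proof.
by rewrite -mulN1r absM (@abs_root1 _ 2) ?mul1r // expr2 mulrNN mulr1.
Qed.

Lemma absV x : abs x^-1 = (abs x)^-1.
Proof.
have [->|x0] := eqVneq x 0; first by rewrite invr0 abs0 invr0.
by apply: (mulfI (x := abs x)); rewrite ?abs_eq0 // -absM !divff ?abs1 ?abs_eq0.
Qed.

Lemma abs_distC x y : abs (x - y) = abs (y - x).
Proof. by rewrite -opprB absN. Qed.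

Lemma absD_le x y e : abs x <= e -> abs y <= e -> abs (x + y) <= e.
Proof. by move=> xe ye; rewrite (le_trans (abs_max _ _)) // ge_max xe. Qed.

Lemma absB_le x y e : abs x <= e -> abs y <= e -> abs (x - y) <= e.
Proof. by move=> xe ye; rewrite absD_le ?absN. Qed.

Lemma absD_lt x y e : abs x < e -> abs y < e -> abs (x + y) < e.
Proof. by move=> xe ye; rewrite (le_lt_trans (abs_max _ _)) // gt_max xe. Qed.

Lemma absB_lt x y e : abs x < e -> abs y < e -> abs (x - y) < e.
Proof. by move=> xe ye; rewrite absD_lt ?absN. Qed.

(** Isosceles principle: were [x + y] smaller than [y], then [y = (x + y) - x] would be smaller than
    itself. *)
Lemma absD_eq x y : abs x < abs y -> abs (x + y) = abs y.
Proof.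
move=> xy; apply/eqP; rewrite eq_le absD_le ?(ltW xy) //= leNgt; apply/negP => h.
by have := absB_lt h xy; rewrite addrC addKr ltxx.
Qed.

Lemma absM_le1 x y : abs x <= 1 -> abs y <= 1 -> abs (x * y) <= 1.
Proof. by move=> *; rewrite absM mulr_ile1 ?abs_ge0. Qed.

Lemma absX_le1 x n : abs x <= 1 -> abs (x ^+ n) <= 1.
Proof. by move=> *; rewrite absX exprn_ile1 ?abs_ge0. Qed.

Lemma abs_sum_le (I : Type) (r : seq I) (P : pred I) (f : I -> K) e :
  0 <= e -> (forall i, P i -> abs (f i) <= e) ->
  abs (\sum_(i <- r | P i) f i) <= e.
Proof.
by move=> e0 fe; elim/big_ind: _ => [|x y|//]; rewrite ?abs0 //; apply: absD_le.
Qed.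

End UltrametricAbs.

Section ResidueField.
Variables (R : realType) (K : fieldType).

(** Function and axioms are bundled so that the subring, ideal and field instances below can be
    inferred from the absolute value alone. *)
Record ultrametric := Ultrametric { uabs :> K -> R; _ : is_abs uabs }.

Lemma ultrametricP (a : ultrametric) : is_abs a. Proof. by case: a. Qed.

Definition unit_ball (a : ultrametric) : {pred K} := fun x => a x <= 1.

Lemma unit_ball_subring a : subring_closed (unit_ball a).
Proof.
have aP := ultrametricP a.
by split=> [|x y|x y]; rewrite -!topredE /= /unit_ball ?abs1 //;
  [apply: absB_le | apply: absM_le1].
Qed.

HB.instance Definition _ a :=
  GRing.isSubringClosed.Build K (unit_ball a) (unit_ball_subring a).

Record integers (a : ultrametric) :=
  Integers { int_val :> K; _ : int_val \in unit_ball a }.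

HB.instance Definition _ a := [isSub for @int_val a].
HB.instance Definition _ a := [Choice of integers a by <:].
HB.instance Definition _ a :=
  [SubChoice_isSubComNzRing of integers a by <:].

Definition open_ball (a : ultrametric) : {pred integers a} := fun x => a (val x) < 1.

Arguments open_ball a : clear implicits.

Lemma open_ball_ideal a : idealr_closed (open_ball a).
Proof.
have aP := ultrametricP a.
split=> [||x y z]; rewrite -!topredE /= /open_ball.
- by rewrite rmorph0 abs0 // ltr01.
- by rewrite rmorph1 abs1 // ltxx.
move=> y1 z1; rewrite rmorphD rmorphM absD_lt // absM //.
rewrite (le_lt_trans _ y1) // ler_piMl ?abs_ge0 //; exact: (valP x).
Qed.

HB.instance Definition _ a :=
  isIdealr.Build (integers a) (open_ball a) (open_ball_ideal a).

Definition residue a := {ideal_quot (open_ball a)}.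
HB.instance Definition _ a := GRing.ComNzRing.on (residue a).

Lemma residue_eq0 a (x : integers a) : (\pi_(residue a) x == 0) = (a (val x) < 1).
Proof. by rewrite -[0](rmorph0 \pi_(residue a)) -Quotient.idealrBE subr0. Qed.

(** A nonzero class has a representative of absolute value at least 1, whose inverse in [K] is again
    integral. *)
Lemma residue_invertible a (x : residue a) : x != 0 -> exists y, y * x == 1.
Proof.
have aP := ultrametricP a.
rewrite -[x]reprK residue_eq0 -leNgt => x1.
have xV : (val (repr x))^-1 \in unit_ball a.
  by rewrite -topredE /= /unit_ball absV // invf_le1 // (lt_le_trans ltr01).
exists (\pi_(residue a) (Integers xV)); rewrite -rmorphM -(rmorph1 \pi_(residue a)).
apply/eqP; congr (\pi _); apply: val_inj; rewrite rmorphM rmorph1 /= mulVf //.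
by rewrite -(abs_eq0 aP) gt_eqF // (lt_le_trans ltr01).
Qed.

Definition residue_inv a (x : residue a) : residue a :=
  if @idP (x != 0) is ReflectT x0 then xchoose (residue_invertible x0) else 0.

Lemma residue_mulV a : forall x : residue a, x != 0 -> residue_inv x * x = 1.
Proof.
move=> x x0; rewrite /residue_inv; case: {-}_ / idP => // h.
exact/eqP/(xchooseP (residue_invertible h)).
Qed.

Lemma residue_inv0 a : residue_inv (0 : residue a) = 0.
Proof. by rewrite /residue_inv; case: {-}_ / idP => // h; case/eqP: (h). Qed.

HB.instance Definition _ a :=
  GRing.ComNzRing_isField.Build (residue a) (@residue_mulV a) (@residue_inv0 a).

(** Total on [K]: [insubd] replaces a non-integral element by 0, which is why the rules below assume
    [a x <= 1]. *)
Definition red a (x : K) : residue a := \pi_(residue a) (insubd (0 : integers a) x).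

Variable a : ultrametric.
Implicit Types x y : K.

Lemma red_int (x : integers a) : red a (val x) = \pi_(residue a) x.
Proof. by rewrite /red valKd. Qed.

Lemma red_spec x : a x <= 1 -> exists2 z : integers a, x = val z & red a x = \pi_(residue a) z.
Proof. by move=> x1; exists (Integers (x1 : x \in unit_ball a)); rewrite -?red_int. Qed.

Lemma red0 : red a 0 = 0.
Proof. by rewrite -[0 in LHS](rmorph0 (val : integers a -> _)) red_int rmorph0. Qed.

Lemma red1 : red a 1 = 1.
Proof. by rewrite -[1 in LHS](rmorph1 (val : integers a -> _)) red_int rmorph1. Qed.

Lemma redD x y : a x <= 1 -> a y <= 1 -> red a (x + y) = red a x + red a y.
Proof.
by move=> /red_spec[x' -> ->] /red_spec[y' -> ->]; rewrite -!rmorphD red_int.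
Qed.

Lemma redB x y : a x <= 1 -> a y <= 1 -> red a (x - y) = red a x - red a y.
Proof.
by move=> /red_spec[x' -> ->] /red_spec[y' -> ->]; rewrite -!rmorphB red_int.
Qed.

Lemma redM x y : a x <= 1 -> a y <= 1 -> red a (x * y) = red a x * red a y.
Proof.
by move=> /red_spec[x' -> ->] /red_spec[y' -> ->]; rewrite -!rmorphM red_int.
Qed.

Lemma redX x n : a x <= 1 -> red a (x ^+ n) = red a x ^+ n.
Proof. by move=> /red_spec[x' -> ->]; rewrite -!rmorphXn red_int. Qed.

Lemma red_eq0 x : a x <= 1 -> (red a x == 0) = (a x < 1).
Proof. by move=> /red_spec[x' -> ->]; rewrite residue_eq0. Qed.

Lemma red_eq x y : a x <= 1 -> a y <= 1 -> (red a x == red a y) = (a (x - y) < 1).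
Proof.
move=> x1 y1; rewrite -subr_eq0 -redB // red_eq0 //.
exact: (absB_le (ultrametricP a)).
Qed.

Lemma red_surj (t : residue a) : exists2 x, a x <= 1 & red a x = t.
Proof. by exists (val (repr t)); [case: (repr t) | rewrite red_int reprK]. Qed.

Lemma red_sum (I : Type) (r : seq I) (f : I -> K) :
  (forall i, a (f i) <= 1) -> red a (\sum_(i <- r) f i) = \sum_(i <- r) red a (f i).
Proof.
move=> f1; elim: r => [|i r IHr]; first by rewrite !big_nil red0.
by rewrite !big_cons redD ?IHr //; apply: abs_sum_le => //; apply: ultrametricP.
Qed.

End ResidueField.

(** * Algebras over a finite field *)

Section FiniteFieldAlgebras.
Variable F : finFieldType.
Local Notation q := #|F|.

(** The map [i] forces [A] to have the characteristic p of [F], and q is a power of p. *)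
Lemma exprDq (A : comNzRingType) (i : {rmorphism F -> A}) (n : nat) :
  {morph (fun x : A => x ^+ (q ^ n)) : x y / x + y}.
Proof.
have [p p_pr pF] := finPcharP F.
have qp : p.-nat q by rewrite -(cardsT (pPrimeCharType pF)); apply: pprimeChar_pgroup.
move=> x y; apply: exprDn_pchar; rewrite pnatX; apply/orP; left.
by apply: sub_in_pnat qp => l _; rewrite inE => /eqP ->; apply: (rmorph_pchar i).
Qed.

Lemma exprBq (A : comNzRingType) (i : {rmorphism F -> A}) (n : nat) :
  {morph (fun x : A => x ^+ (q ^ n)) : x y / x - y}.
Proof.
move=> x y; apply/eqP; rewrite eq_sym subr_eq; apply/eqP.
by rewrite -(exprDq i) subrK.
Qed.

(** Packaged as a morphism so that the power map can be applied to the coefficients of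
    polynomials. *)
Lemma frobenius_rmorphism (A : comNzRingType) (i : {rmorphism F -> A}) (n : nat) :
  exists f : {rmorphism A -> A}, forall x, f x = x ^+ (q ^ n).
Proof.
pose f (x : A) := x ^+ (q ^ n).
have fD : zmod_morphism f by move=> x y; apply: exprBq.
have fM : monoid_morphism f by split=> [|x y]; rewrite /f ?expr1n ?exprMn.
pose fDM := GRing.isZmodMorphism.Build A A f fD.
pose fMM := GRing.isMonoidMorphism.Build A A f fM.
pose g : {rmorphism A -> A} := HB.pack f fDM fMM.
by exists g.
Qed.

Variables (k : fieldType) (i : {rmorphism F -> k}).

(** X^q - X is the product of the X - c for c in [F]; evaluate both sides at [x]. *)
Lemma frobenius_fixedP (x : k) : x ^+ q = x -> exists c, x = i c.
Proof.
move=> xq; have := congr1 (fun p => (map_poly i p).[x]) (finField_genPoly F).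
rewrite rmorphB /= map_polyXn map_polyX !hornerE xq subrr rmorph_prod.
rewrite horner_prod => /esym/eqP; rewrite prodf_seq_eq0 => /hasP[c _ /=].
rewrite rmorphB /= map_polyX map_polyC !hornerE subr_eq0 => /eqP; by exists c.
Qed.

Lemma map_frobenius_fixedP (P : {poly k}) :
  (forall j, P`_j ^+ q = P`_j) -> exists P0, P = map_poly i P0.
Proof.
move=> sP; have h j : {c | P`_j = i c} by apply/cid/frobenius_fixedP/sP.
exists (\poly_(j < size P) projT1 (h j)); apply/polyP => j.
rewrite coef_map coef_poly; case: ltnP => [_|jP]; first by case: (h j).
by rewrite nth_default //= rmorph0.
Qed.

Lemma frobenius_inj (n : nat) (x y : k) : x ^+ (q ^ n) = y ^+ (q ^ n) -> x = y.
Proof.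
move/eqP; rewrite -subr_eq0 -(exprBq i) expf_eq0 subr_eq0.
by case/andP=> _ /eqP.
Qed.

(* Pigeonhole on the residues of the monomials X^(q^j) modulo P. *)
Lemma root_frobenius_periodic (P : {poly F}) (x : k) :
  P != 0 -> root (map_poly i P) x ->
  exists2 m, (0 < m)%N & x ^+ (q ^ m) = x.
Proof.
move=> P0 /eqP Px; pose n := size P.
pose f (j : 'I_(#|{: 'rV[F]_n}|.+1)) : 'rV[F]_n := poly_rV ('X^(q ^ j) %% P).
have /injectivePn[a [b ab fab]] : ~~ injectiveb f.
  apply/negP => /injectiveP /leq_card; by rewrite card_ord ltnn.
(* Since [P] vanishes at [x], only the remainder of X^(q^j) matters there, so equal remainders give
   equal powers of [x]. *)
have xE (j : 'I__) : x ^+ (q ^ j) = (map_poly i (rVpoly (f j))).[x].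
  rewrite poly_rV_K; last by rewrite ltnW // ltn_modp.
  rewrite -hornerXn -(map_polyXn i) {1}(divp_eq 'X^(q ^ j) P) rmorphD rmorphM /=.
  by rewrite hornerD hornerM Px mulr0 add0r.
wlog ltab : a b ab fab / (a < b)%N => [IH|].
  have [|/IH|/val_inj/eqP] := ltngtP a b; [exact: IH| |by rewrite (negPf ab)].
  by apply; rewrite // eq_sym.
exists (b - a)%N; first by rewrite subn_gt0.
apply: (@frobenius_inj a); rewrite -exprM -expnD subnK ?(ltnW ltab) //.
by rewrite !xE fab.
Qed.

Lemma frobenius_iter (m n : nat) (x : k) :
  x ^+ (q ^ m) = x -> x ^+ (q ^ (n * m)) = x.
Proof.
move=> xm; elim: n => [|n IHn]; first by rewrite mul0n expr1.
by rewrite mulSn expnD exprM xm.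
Qed.

End FiniteFieldAlgebras.

(** * Norms of polynomials along the iterates of a coefficientwise endomorphism *)

Section TwistedNorm.
Variables (k : fieldType) (s : {rmorphism k -> k}).

Definition twisted_norm (m : nat) (P : {poly k}) : {poly k} :=
  \prod_(j < m) iter j (map_poly s) P.

(** Applying [s] shifts the factors by one place; the new last factor is the m-th iterate of [P],
    that is, the old first one. *)
Lemma twisted_norm_fixed m P : iter m (map_poly s) P = P ->
  map_poly s (twisted_norm m P) = twisted_norm m P.
Proof.
case: m => [|m] sP; rewrite /twisted_norm rmorph_prod; first by rewrite !big_ord0.
by rewrite big_ord_recr [RHS]big_ord_recl /= mulrC -iterS sP.
Qed.

Lemma iter_map_poly_neq0 j P : P != 0 -> iter j (map_poly s) P != 0.
Proof. by move=> P0; elim: j => //= j; rewrite map_poly_eq0. Qed.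

Lemma twisted_norm_neq0 m P : P != 0 -> twisted_norm m P != 0.
Proof.
by move=> P0; apply/prodf_neq0 => j _; apply: iter_map_poly_neq0.
Qed.

End TwistedNorm.

(** * Places of extensions of the rational function field *)

Lemma irreducible_coprimep (F : fieldType) (v p : {poly F}) :
  irreducible_poly v -> ~~ (v %| p) -> coprimep v p.
Proof.
move=> [v1 vP] vp; apply/negPn/negP => /vP/(_ (dvdp_gcdl v p)) e.
by move: vp; rewrite -(eqp_dvdl _ e) dvdp_gcdr.
Qed.

(** Horner induction: the denominator of each new constant coefficient multiplies the common one
    found so far. *)
Lemma clear_denominators (A : idomainType) (p : {poly {fraction A}}) :
  exists (d : A) (r : {poly A}),
    d != 0 /\ map_poly (@FracField.tofrac A) r = FracField.tofrac d *: p.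
Proof.
have fracE (x : {fraction A}) : exists n d : A,
    d != 0 /\ FracField.tofrac d * x = FracField.tofrac n.
  elim/quotW: x => r; exists (frac r).1, (frac r).2; split; first exact: denom_ratioP.
  unlock FracField.tofrac; rewrite -[LHS]FracField.pi_mul.
  apply/eqmodP; rewrite /= FracField.equivfE /FracField.mulf.
  by rewrite !numden_Ratio ?mul1r ?mulr1 ?oner_neq0 ?denom_ratioP // mulrC.
elim/poly_ind: p => [|p x [d [r [d0 rE]]]].
  by exists 1, 0; rewrite oner_neq0 rmorph0 scaler0.
have [n [e [e0 eE]]] := fracE x.
exists (d * e), (e *: r * 'X + (d * n)%:P); split; first by rewrite mulf_neq0.
rewrite rmorphD rmorphM /= map_polyX map_polyC map_polyZ rE scalerDr scalerA.
rewrite -rmorphM /= [e * d]mulrC -scalerAl; congr (_ + _).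
by rewrite -mul_polyC -polyCM !tofracM -eE mulrA.
Qed.

Section FunctionField.
Variables (R : realType) (F : finFieldType) (K : fieldType).
Variables (g : {rmorphism {poly F} -> K}) (av : ultrametric R K) (v : {poly F}).
Hypotheses (v_irr : irreducible_poly v).
Hypotheses (g_inj : injective g) (av_int : forall P, av (g P) <= 1) (av_v : av (g v) < 1).
Local Notation q := #|F|.
Local Notation k := (residue av).
Let avP := ultrametricP av.

(** Bezout writes a nonzero constant, of absolute value 1, as a combination of [v] and [P]. As [g v]
    is small and all of [g] is integral, [g P] cannot be small too. *)
Lemma av_unit P : ~~ (v %| P) -> av (g P) = 1.
Proof.
move=> /(irreducible_coprimep v_irr)/Bezout_coprimepP[[a b] /=].
rewrite -size_poly_eq1 => /size_poly1P[c c0 E].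
have : av (g c%:P) = 1.
  apply: (abs_root1 avP (n := q.-1)); first by
    rewrite -ltnS prednK ?finNzRing_gt1 // (ltn_trans _ (finNzRing_gt1 _)).
  rewrite -rmorphXn -polyC_exp; apply: (mulfI (x := g c%:P)).
    by rewrite raddf_eq0 // polyC_eq0.
  rewrite -rmorphM -polyCM -exprS prednK; last exact: ltn_trans (finNzRing_gt1 F).
  by rewrite expf_card mulr1.
rewrite -E rmorphD !rmorphM => E1; apply/eqP; rewrite eq_le av_int /= leNgt.
apply/negP => P1; have := ltxx (1 : R); rewrite -{1}E1 absD_lt //.
  by rewrite absM // (le_lt_trans _ av_v) // ler_piMl ?abs_ge0.
by rewrite absM // (le_lt_trans _ P1) // ler_piMl ?abs_ge0.
Qed.

Lemma residue_constants :
  exists i : {rmorphism F -> k}, forall c, i c = red av (g c%:P).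
Proof.
pose f (c : F) := red av (g c%:P).
have fD : zmod_morphism f by move=> x y; rewrite /f polyCB rmorphB redB.
have fM : monoid_morphism f.
  by split=> [|x y]; rewrite /f ?rmorph1 ?red1 // polyCM rmorphM redM.
pose fDM := GRing.isZmodMorphism.Build F k f fD.
pose fMM := GRing.isMonoidMorphism.Build F k f fM.
pose h : {rmorphism F -> k} := HB.pack f fDM fMM.
by exists h.
Qed.

Variable i : {rmorphism F -> k}.
Hypothesis iE : forall c, i c = red av (g c%:P).
Local Notation th := (red av (g 'X)).

Lemma red_horner P : red av (g P) = (map_poly i P).[th].
Proof.
elim/poly_ind: P => [|P c IH]; first by rewrite !rmorph0 horner0 red0.
rewrite !rmorphD !rmorphM /= map_polyX map_polyC !hornerE -IH /= iE.
by rewrite redD ?redM ?absM_le1.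
Qed.

Lemma theta_periodic : exists2 m, (0 < m)%N & th ^+ (q ^ m) = th.
Proof.
apply: (@root_frobenius_periodic _ _ i v); last by rewrite rootE -red_horner red_eq0.
by rewrite irredp_neq0.
Qed.

Lemma red_poly_periodic m P :
  th ^+ (q ^ m) = th -> red av (g P) ^+ (q ^ m) = red av (g P).
Proof.
move=> thm; have [f fE] := frobenius_rmorphism i m.
rewrite red_horner -fE -horner_map fE thm -map_poly_comp.
congr (_.[_]); apply: eq_map_poly => c /=.
rewrite fE -rmorphXn; congr (i _).
by elim: m {thm f fE} => [|m IHm]; rewrite ?expr1 // expnSr exprM IHm expf_card.
Qed.

(** As long as [v] divides every coefficient it can be divided out. Each division shortens the
    leading coefficient, since [v] is not constant, so the process stops. *)
Lemma primitive_annihilator x (p : {poly {poly F}}) :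
  p != 0 -> root (map_poly g p) x ->
  exists2 r : {poly {poly F}}, (exists j, ~~ (v %| r`_j)) & root (map_poly g r) x.
Proof.
have [n] := ubnP (size (lead_coef p)); elim: n => // n IHn in p * => sp p0 px.
have [h|h] := pselect (exists j, ~~ (v %| p`_j)); first by exists p.
have {}h j : v %| p`_j by apply/negPn/negP => hj; apply: h; exists j.
pose r := \poly_(j < size p) (p`_j %/ v).
have v0 : v != 0 by rewrite irredp_neq0.
have pE : p = v *: r.
  apply/polyP => j; rewrite coefZ coef_poly mulrC; case: ltnP => jp.
    by rewrite divpK.
  by rewrite mul0r nth_default.
have r0 : r != 0 by apply: contraNneq p0 => r0; rewrite pE r0 scaler0.
apply: (IHn r) => //.
  move: sp; rewrite pE lead_coefZ size_mul ?lead_coef_eq0 // ltnS.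
  case: v_irr => v1 _; apply: leq_trans.
  by rewrite -ltnS prednK ?addn_gt0 ?(ltn_trans _ v1) // -addn2 addnC leq_add2r.
by move: px; rewrite pE map_polyZ rootZ // raddf_eq0.
Qed.

(** An annihilator that is primitive at [v] stays nonzero modulo [v]. Its reduction has coefficients
    in F[th], and a twisted norm brings them down to [F], where the pigeonhole lemma applies. *)
Lemma residue_periodic x (p : {poly {poly F}}) :
  av x <= 1 -> p != 0 -> root (map_poly g p) x ->
  exists m, [/\ (0 < m)%N, th ^+ (q ^ m) = th & red av x ^+ (q ^ m) = red av x].
Proof.
move=> x1 p0 /(primitive_annihilator p0)[{p0}p [j pj] px].
have [m m0 thm] := theta_periodic.
have [f fE] := frobenius_rmorphism i 1.
have [h hE] : exists h : {rmorphism {poly F} -> k}, forall P, h P = red av (g P).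
  by exists (horner_eval th \o map_poly i) => P; exact/esym/red_horner.
(* The coefficient not divisible by [v] is a unit at [v], hence survives reduction. *)
have P0 : map_poly h p != 0.
  apply/eqP => /polyP/(_ j); rewrite coef_map coef0 /= hE => /eqP.
  by rewrite red_eq0 // av_unit // ltxx.
have Px : (map_poly h p).[red av x] = 0.
  have gp l : av (map_poly g p)`_l <= 1 by rewrite coef_map; apply: av_int.
  have gx l : av ((map_poly g p)`_l * x ^+ l) <= 1.
    exact: (absM_le1 avP (gp l) (absX_le1 avP l x1)).
  rewrite (@horner_coef_wide _ (size p) (map_poly h p) _ (size_poly _ _)).
  apply: etrans (etrans (congr1 (red av) (eqP px)) (red0 av)).
  rewrite (@horner_coef_wide _ (size p) (map_poly g p) _ (size_poly _ _)).
  rewrite red_sum //; apply: eq_bigr => l _.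
  by rewrite redM ?(absX_le1 avP) // redX // !coef_map /= hE.
have iterE n P l : (iter n (map_poly f) P)`_l = P`_l ^+ (q ^ n).
  elim: n => [|n IHn] /=; first by rewrite expr1.
  by rewrite coef_map IHn /= fE -exprM -expnSr.
(* The coefficients have period m under Frobenius, so the norm is fixed by [f] and descends to
   [F]. *)
have [P0' NE] : exists P0', twisted_norm f m (map_poly h p) = map_poly i P0'.
  apply: map_frobenius_fixedP => l; rewrite -[in RHS](@twisted_norm_fixed _ f).
    by rewrite coef_map /= fE.
  by apply/polyP => n; rewrite iterE coef_map /= hE red_poly_periodic.
have [||n n0 xn] := @root_frobenius_periodic _ _ i P0' (red av x).
- by rewrite -(map_poly_eq0 i) -NE twisted_norm_neq0.
- rewrite -NE rootE /twisted_norm horner_prod; apply/eqP.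
  by case: (m) m0 => // m' _; rewrite big_ord_recl /= Px mul0r.
(* m is a period of [th] and n one of the class of [x]; the product is a common period. *)
exists (n * m)%N; split; first by rewrite muln_gt0 n0.
  exact: frobenius_iter.
by rewrite mulnC; apply: frobenius_iter.
Qed.

Variable ai : ultrametric R K.
Hypothesis aiE : forall P, P != 0 -> ai (g P) = q%:R ^+ (size P).-1.

(** The witness is 1 / (1 + v^N): at infinity v^N is large, at [v] it is close to 0. *)
Lemma weak_approximation (M : R) : 0 < M ->
  exists e : K, [/\ ai e <= M, av (e - 1) < 1 & av e <= 1].
Proof.
have aiP := ultrametricP ai.
(* N exceeds 1/M, and |v^N| >= q^N >= 2^N > N at infinity. *)
move=> M0; pose N := (Num.bound M^-1).+1.
have v0 : v != 0 by rewrite irredp_neq0.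
have aiN : N%:R < ai (g v ^+ N).
  rewrite absX // aiE //; case: v_irr => v1 _.
  rewrite (@lt_le_trans _ _ ((2 ^ N)%:R)) //; first by rewrite ltr_nat ltn_expl.
  rewrite natrX lerXn2r ?nnegrE ?exprn_ge0 // (@le_trans _ _ q%:R) //.
    by rewrite ler_nat finNzRing_gt1.
  rewrite ler_eXnr ?ler1n ?(ltnW (finNzRing_gt1 _)) // -ltnS prednK //.
  exact: ltn_trans v1.
have MN : M^-1 < N%:R.
  by rewrite (lt_trans (archi_boundP _)) ?invr_ge0 ?ltW // ltr_nat.
have dE : ai (1 + g v ^+ N) = ai (g v ^+ N).
  by rewrite absD_eq // abs1 // (le_lt_trans _ aiN) // ler1n.
have vN : av (g v ^+ N) < 1.
  rewrite absX // exprn_ilt1 ?abs_ge0 //.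
have dv : av (1 + g v ^+ N) = 1 by rewrite addrC absD_eq ?abs1.
have d0 : 1 + g v ^+ N != 0 by rewrite -(abs_eq0 avP) dv oner_neq0.
exists (1 + g v ^+ N)^-1; rewrite !absV // dE dv invr1; split=> //.
  rewrite -[M]invrK lef_pV2 ?posrE ?invr_gt0 //; first exact/ltW/(lt_trans MN).
  by rewrite (lt_trans _ aiN) // ltr0n.
have -> : (1 + g v ^+ N)^-1 - 1 = - (g v ^+ N / (1 + g v ^+ N)).
  by rewrite -[X in _ - X](divff d0) -{1}[_^-1]mul1r -mulrBl opprD addrA subrr sub0r mulNr.
by rewrite absN // absM // absV // dv invr1 mulr1.
Qed.

End FunctionField.

(** * Linear quotients and Frobenius eigenvectors *)

Section LinearQuotient.
Variables (K C : fieldType) (G : {rmorphism K -> C}).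

Record linear_subspace := Subspace {
  subspace_set :> C -> Prop;
  subspace0 : subspace_set 0;
  subspaceD : forall x y, subspace_set x -> subspace_set y -> subspace_set (x + y);
  subspaceZ : forall a x, subspace_set x -> subspace_set (G a * x) }.

(** Quotients are built from boolean predicates, so membership is decided classically. *)
Definition subspace_mem (W : linear_subspace) : {pred C} := fun x => `[< W x >].

Lemma subspace_memP (W : linear_subspace) x : reflect (W x) (x \in subspace_mem W).
Proof. exact: asboolP. Qed.

Lemma subspace_zmod W : zmod_closed (subspace_mem W).
Proof.
split=> [|x y /subspace_memP Wx /subspace_memP Wy]; apply/subspace_memP.
  exact: subspace0.
by apply: subspaceD => //; rewrite -mulN1r -(rmorphN1 G); apply: subspaceZ.
Qed.

HB.instance Definition _ W :=
  GRing.isZmodClosed.Build C (subspace_mem W) (subspace_zmod W).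

(** The quotient is formed with respect to the additive subgroup underlying [W]; scaling by [K] is
    put back through representatives. *)
Definition linear_quotient (W : linear_subspace) := {ideal_quot (subspace_mem W)}.
HB.instance Definition _ W := GRing.Zmodule.on (linear_quotient W).

Definition quotient_class (W : linear_subspace) (x : C) : linear_quotient W :=
  \pi_{ideal_quot (subspace_mem W)} x.

Definition quotient_scale (W : linear_subspace) (a : K) (x : linear_quotient W) :=
  quotient_class W (G a * repr x).

Variable W : linear_subspace.
Local Notation cl := (quotient_class W).

Lemma quotient_classD x y : cl (x + y) = cl x + cl y.
Proof. by rewrite /quotient_class -raddfD. Qed.

Lemma quotient_classB x y : cl (x - y) = cl x - cl y.
Proof. by rewrite /quotient_class -raddfB. Qed.

HB.instance Definition _ := GRing.isZmodMorphism.Build C (linear_quotient W) cl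
  quotient_classB.

Lemma quotient_class_eq0 x : (cl x = 0) <-> W x.
Proof.
rewrite (rwP eqP) -[0](raddf0 \pi_{ideal_quot (subspace_mem W)}) /quotient_class.
rewrite -Quotient.idealrBE subr0; by split=> /subspace_memP.
Qed.

Lemma quotient_scaleE a x : quotient_scale a (cl x) = cl (G a * x).
Proof.
apply/eqP; rewrite -subr_eq0 -quotient_classB -mulrBr; apply/eqP/quotient_class_eq0.
apply: subspaceZ; apply/quotient_class_eq0.
by rewrite quotient_classB [X in X - _]reprK subrr.
Qed.

Lemma quotient_classP (x : linear_quotient W) : exists y, x = cl y.
Proof. by exists (repr x); rewrite /quotient_class reprK. Qed.

Lemma quotient_scaleA a b (x : linear_quotient W) :
  quotient_scale a (quotient_scale b x) = quotient_scale (a * b) x.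
Proof.
by have [y ->] := quotient_classP x; rewrite !quotient_scaleE mulrA rmorphM.
Qed.

Lemma quotient_scale1 : left_id 1 (@quotient_scale W).
Proof.
by move=> x; have [y ->] := quotient_classP x; rewrite quotient_scaleE rmorph1 mul1r.
Qed.

Lemma quotient_scaleDr : right_distributive (@quotient_scale W) +%R.
Proof.
move=> a x y; have [x' ->] := quotient_classP x; have [y' ->] := quotient_classP y.
by rewrite -quotient_classD !quotient_scaleE mulrDr quotient_classD.
Qed.

Lemma quotient_scaleDl (x : linear_quotient W) :
  {morph (@quotient_scale W)^~ x : a b / a + b}.
Proof.
move=> a b; have [y ->] := quotient_classP x.
by rewrite !quotient_scaleE rmorphD mulrDl quotient_classD.
Qed.

HB.instance Definition _ := GRing.Zmodule_isLmodule.Build K (linear_quotient W)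
  quotient_scaleA quotient_scale1 quotient_scaleDr quotient_scaleDl.

Lemma quotient_classZ a x : cl (G a * x) = a *: cl x.
Proof. by rewrite -quotient_scaleE. Qed.

End LinearQuotient.

Section FrobeniusEigenvector.
Variables (F : finFieldType) (K k : fieldType) (V : lmodType K).
Variables (g : {rmorphism {poly F} -> K}) (i : {rmorphism F -> k}).
Variables (th : k) (s : nat) (tau : {additive k -> V}).
Local Notation q := #|F|.
Hypotheses (g_inj : injective g) (s_gt0 : (0 < s)%N).
Hypothesis tauZ : forall c x, tau (i c * x) = g c%:P *: tau x.
Hypothesis tau_frobenius : forall x,
  tau (x ^+ q) =
  \sum_(j < s.+1) (g 'X ^+ (s - j) *: tau ((- th) ^+ j * x)) *+ 'C(s, j).

(** Extends [tau] from constants to k[X], with X acting on [V] as [g 'X]. Two copies of theta thus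
    coexist: the variable X, acting through scalars of [K], and [th] inside the argument of
    [tau]. *)
Definition beta (P : {poly k}) : V := \sum_(j < size P) g 'X ^+ j *: tau P`_j.

Lemma betaE n (P : {poly k}) :
  (size P <= n)%N -> beta P = \sum_(j < n) g 'X ^+ j *: tau P`_j.
Proof.
move=> Pn; rewrite /beta -!(big_mkord predT (fun j => g 'X ^+ j *: tau P`_j)).
rewrite (big_cat_nat _ Pn) //= -[LHS]addr0; congr (_ + _).
rewrite big_nat_cond big1 // => j; rewrite andbT => /andP[Pj _].
by rewrite nth_default // raddf0 scaler0.
Qed.

Lemma betaD P Q : beta (P + Q) = beta P + beta Q.
Proof.
rewrite (betaE (leq_maxl (size P) (size Q))) (betaE (leq_maxr (size P) (size Q))).
rewrite (betaE (size_polyD P Q)) -big_split; apply: eq_bigr => j _.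
by rewrite coefD raddfD scalerDr.
Qed.

Lemma beta0 : beta 0 = 0.
Proof. by rewrite /beta size_poly0 big_ord0. Qed.

Lemma beta_sum (I : Type) (r : seq I) (P : I -> {poly k}) :
  beta (\sum_(j <- r) P j) = \sum_(j <- r) beta (P j).
Proof. exact: (big_morph _ betaD beta0). Qed.

Lemma betaMn P n : beta (P *+ n) = beta P *+ n.
Proof. by elim: n => [|n IHn]; rewrite ?mulr0n ?beta0 // !mulrS betaD IHn. Qed.

Lemma betaC c : beta c%:P = tau c.
Proof. by rewrite (betaE (size_polyC_leq1 c)) big_ord1 coefC expr0 scale1r. Qed.

Lemma betaMX P : beta (P * 'X) = g 'X *: beta P.
Proof.
have PX : (size (P * 'X)%R <= (size P).+1)%N.
  by rewrite (leq_trans (size_polyMleq _ _)) // size_polyX addn2.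
rewrite (betaE PX) big_ord_recl coefMX /= raddf0 scaler0 add0r scaler_sumr.
by apply: eq_bigr => j _; rewrite coefMX scalerA -exprS.
Qed.

Lemma betaXn n P : beta ('X^n * P) = g 'X ^+ n *: beta P.
Proof.
rewrite mulrC; elim: n => [|n IHn]; first by rewrite mulr1 scale1r.
by rewrite exprSr mulrA betaMX IHn scalerA exprS.
Qed.

Lemma beta_map_poly Q P : beta (map_poly i Q * P) = g Q *: beta P.
Proof.
elim/poly_ind: Q => [|Q c IHQ]; first by rewrite !rmorph0 mul0r scale0r beta0.
rewrite !rmorphD !rmorphM /= map_polyX map_polyC mulrDl betaD mulrAC betaMX IHQ.
rewrite scalerA [g 'X * _]mulrC scalerDl; congr (_ + _).
have Ps : (size ((i c)%:P * P)%R <= size P)%N by rewrite mul_polyC size_scale_leq.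
rewrite (betaE Ps) scaler_sumr; apply: eq_bigr => j _.
by rewrite coefCM tauZ !scalerA mulrC.
Qed.

(** On constants this is [tau_frobenius], whose right-hand side is the binomial expansion of (X -
    th)^s. It extends to all [P] because [f] leaves X alone. *)
Lemma beta_frobenius (f : {rmorphism k -> k}) P : (forall x, f x = x ^+ q) ->
  beta (map_poly f P) = beta (('X - th%:P) ^+ s * P).
Proof.
move=> fE; elim/poly_ind: P => [|P c IHP]; first by rewrite rmorph0 mulr0.
rewrite rmorphD rmorphM /= map_polyX map_polyC betaD betaMX IHP.
rewrite mulrDr betaD mulrA betaMX; congr (_ + _).
rewrite betaC /= fE tau_frobenius exprDn mulr_suml beta_sum; apply: eq_bigr => j _.
by rewrite mulrnAl betaMn -polyCN -polyC_exp -mulrA -polyCM betaXn betaC.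
Qed.

(* With y^(q^m) = y for all coefficients in sight, the map
   P |-> ('X - th)^s * P^(q^(m-1)) preserves [beta]; its m-th iterate multiplies
   [x] by a polynomial over F of positive degree. *)
Lemma frobenius_eigenvector_eq0 m x :
  (0 < m)%N -> th ^+ (q ^ m) = th -> x ^+ (q ^ m) = x -> tau x = 0.
Proof.
move=> m0 thm xm.
have [f fE] := frobenius_rmorphism i 1; rewrite expn1 in fE.
have [u uE] := frobenius_rmorphism i m.-1.
have [w wE] := frobenius_rmorphism i m.
have fu y : f (u y) = w y by rewrite fE uE wE -exprM -expnSr prednK.
(* The m-th iterate of [u] is the power q^(m(m-1)), whose exponent is a multiple of the period m. *)
have um y : w y = y -> iter m u y = y.
  move=> wy; have -> : iter m u y = y ^+ (q ^ (m * m.-1)).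
    elim: {1 2}m => [|n IHn] /=; first by rewrite mul0n expr1.
    by rewrite uE IHn -exprM -expnD mulSnr.
  by rewrite mulnC; apply: frobenius_iter; rewrite -wE.
pose A := ('X - th%:P) ^+ s; pose U := map_poly u.
have coef_iter n P j : (iter n U P)`_j = iter n u P`_j.
  by elim: n => //= n IHn; rewrite coef_map /= IHn.
have UK P : map_poly w P = P -> iter m U P = P.
  move=> wP; apply/polyP => j; rewrite coef_iter um //.
  by rewrite -[in RHS]wP coef_map.
have wU P : map_poly w P = P -> map_poly w (U P) = U P.
  move=> wP; rewrite -[in RHS]wP; apply/polyP => j.
  by rewrite !coef_map /= !wE !uE -!exprM mulnC.
have wA : map_poly w A = A.
  by rewrite rmorphXn rmorphB /= map_polyX map_polyC /= wE thm.
(* Here [P] is the image of [U P] under [f], because [w] is [f] after [u]; the Frobenius relation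
   applies to [U P]. *)
have step P : map_poly w P = P -> beta P = beta (A * U P).
  move=> wP; rewrite -(beta_frobenius _ fE) -[in LHS]wP; congr beta.
  by apply/polyP => j; rewrite !coef_map /= fu.
have wUn n P : map_poly w P = P -> map_poly w (iter n U P) = iter n U P.
  by move=> wP; elim: n => //= n; apply: wU.
have iterate n : beta x%:P = beta (twisted_norm u n A * iter n U x%:P).
  elim: n => [|n IHn]; first by rewrite /twisted_norm big_ord0 mul1r.
  have wx : map_poly w x%:P = x%:P by rewrite map_polyC /= wE xm.
  rewrite IHn step; last first.
    rewrite rmorphM rmorph_prod /= wUn //; congr (_ * _).
    by apply: eq_bigr => j _; apply: wUn.
  rewrite /twisted_norm big_ord_recl /= /U rmorphM rmorph_prod mulrA.
  by congr (beta (_ * _ * _)).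
have [P0 NE] : exists P0, twisted_norm u m A = map_poly i P0.
  have wN : map_poly w (twisted_norm u m A) = twisted_norm u m A.
    by rewrite rmorph_prod; apply: eq_bigr => j _; apply: wUn.
  have uN := twisted_norm_fixed (UK _ wA).
  apply: map_frobenius_fixedP => j.
  by rewrite -[in RHS]wN coef_map /= -fu -[in LHS]uN coef_map /= fE.
(* The factor of index 0 is (X - th)^s with s > 0. Vanishing at [th] shows that the norm is not the
   constant 1. *)
have Nth : (map_poly i P0).[th] = 0.
  rewrite -NE /twisted_norm horner_prod; case: (m) m0 => // n _.
  by rewrite big_ord_recl /= horner_exp !hornerE subrr expr0n eqn0Ngt s_gt0 mul0r.
have P01 : P0 - 1 != 0.
  apply: contra_eq_neq Nth => /eqP; rewrite subr_eq0 => /eqP ->.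
  by rewrite rmorph1 hornerC oner_neq0.
(* After m rounds [tau x = g P0 *: tau x], and [g P0 - 1] is nonzero by injectivity of [g]. *)
have := iterate m; rewrite UK ?map_polyC /= ?wE ?xm // NE beta_map_poly !betaC.
move=> /eqP; rewrite eq_sym -subr_eq0 -{2}[tau x]scale1r -scalerBl.
rewrite -(rmorph1 g) -rmorphB scaler_eq0 raddf_eq0 // (negPf P01) /=.
by move/eqP.
Qed.
End FrobeniusEigenvector.

(** * Limits for an ultrametric absolute value *)

Section AbsoluteLimits.
Variables (R : realType) (C : fieldType) (abs : C -> R).
Hypothesis absP : is_abs abs.

Lemma abs_cvgP u l : abs_cvg abs u l <->
  forall e, 0 < e -> exists N, forall n, (N <= n)%N -> abs (u n - l) < e.
Proof.
split=> [/cvgrPdist_lt h e e0|h].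
  have [N _ hN] := h e e0; exists N => n Nn.
  by have := hN n Nn; rewrite /= sub0r normrN ger0_norm ?(abs_ge0 absP).
apply/cvgrPdist_lt => e e0; have [N hN] := h e e0; exists N => // n /= Nn.
by rewrite sub0r normrN ger0_norm ?(abs_ge0 absP) // hN.
Qed.

Lemma abs_cvg_unique u l l' : abs_cvg abs u l -> abs_cvg abs u l' -> l = l'.
Proof.
move=> /abs_cvgP ul /abs_cvgP ul'; apply/eqP; rewrite -subr_eq0.
apply/negPn/negP; rewrite -(abs_gt0 absP) => e0.
have [N hN] := ul _ e0; have [N' hN'] := ul' _ e0.
have := absB_lt absP (hN' _ (leq_maxr N N')) (hN _ (leq_maxl N N')).
by rewrite opprB addrC addrA subrK ltxx.
Qed.

Lemma abs_cvg_cst l : abs_cvg abs (fun=> l) l.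
Proof. by apply/abs_cvgP => e e0; exists 0 => n _; rewrite subrr abs0. Qed.

Lemma abs_cvgD u u' l l' : abs_cvg abs u l -> abs_cvg abs u' l' ->
  abs_cvg abs (fun n => u n + u' n) (l + l').
Proof.
move=> /abs_cvgP ul /abs_cvgP ul'; apply/abs_cvgP => e e0.
have [N hN] := ul _ e0; have [N' hN'] := ul' _ e0.
exists (maxn N N') => n; rewrite geq_max => /andP[Nn N'n].
by rewrite opprD addrACA absD_lt ?hN ?hN'.
Qed.

Lemma abs_cvgZ c u l : abs_cvg abs u l -> abs_cvg abs (fun n => c * u n) (c * l).
Proof.
have [->|c0] := eqVneq c 0.
  by move=> _; rewrite mul0r; under eq_fun do rewrite mul0r; apply: abs_cvg_cst.
move=> /abs_cvgP ul; apply/abs_cvgP => e e0; have ac : 0 < abs c by rewrite abs_gt0.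
have [N hN] := ul (e / abs c) (divr_gt0 e0 ac); exists N => n /hN.
by rewrite -mulrBr absM // ltr_pdivlMr // mulrC.
Qed.

Lemma abs_cvg_sum m (u : 'I_m -> nat -> C) (l : 'I_m -> C) :
  (forall j, abs_cvg abs (u j) (l j)) ->
  abs_cvg abs (fun n => \sum_j u j n) (\sum_j l j).
Proof.
elim: m u l => [|m IHm] u l ul.
  by under eq_fun do rewrite big_ord0; rewrite big_ord0; apply: abs_cvg_cst.
under eq_fun do rewrite big_ord_recr; rewrite big_ord_recr /=.
by apply: abs_cvgD => //; apply: IHm.
Qed.

Lemma abs_cvgS u l : abs_cvg abs u l -> abs_cvg abs (fun n => u n.+1) l.
Proof.
move=> /abs_cvgP ul; apply/abs_cvgP => e /ul[N hN].
by exists N => n Nn; apply: hN; rewrite ltnW.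
Qed.

(** By the ultrametric inequality a tail is bounded by its largest term, hence by c r^N. *)
Lemma abs_cvg_series (x : nat -> C) (c r : R) : abs_complete abs ->
  0 <= r < 1 -> 0 <= c -> (forall n, abs (x n) <= c * r ^+ n) ->
  exists l, abs_cvg abs (fun n => \sum_(i < n) x i) l.
Proof.
move=> complete /andP[r0 r1] c0 xr; apply: complete => e e0.
have [N hN] : exists N, c * r ^+ N < e.
  have [->|cn0] := eqVneq c 0; first by exists 0%N; rewrite mul0r.
  have cp : 0 < c by rewrite lt_def cn0.
  have rn : `|r| < 1 by rewrite ger0_norm.
  have /cvgrPdist_lt/(_ _ (divr_gt0 e0 cp))[N _ hN] := cvg_expr rn.
  exists N; have := hN N (leqnn N); rewrite /= sub0r normrN ger0_norm ?exprn_ge0 //.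
  by rewrite ltr_pdivlMr // mulrC.
have cauchy m n : (N <= m)%N -> (m <= n)%N ->
    abs (\sum_(i < n) x i - \sum_(i < m) x i) < e.
  move=> Nm mn; rewrite -!(big_mkord predT) (big_cat_nat _ mn) //= addrAC subrr add0r.
  rewrite big_nat; apply: le_lt_trans hN; apply: (abs_sum_le absP).
    by rewrite mulr_ge0 ?exprn_ge0.
  move=> i /andP[mi _]; apply: le_trans (xr i) _; apply: ler_wpM2l => //.
  by rewrite ler_wiXn2l ?(ltW r1) // (leq_trans Nm).
exists N => m n Nm Nn; have [mn|/ltnW nm] := leqP m n; last exact: cauchy.
by rewrite abs_distC // cauchy.
Qed.

End AbsoluteLimits.

(** * Partial sums of star polylogarithms *)

Section StarSums.
Variables (F : finFieldType) (C : fieldType) (f : {rmorphism {fraction {poly F}} -> C}).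
Local Notation q := #|F|.
Local Notation T := (f (theta F)).
Implicit Types (a : nat * C) (l : seq (nat * C)) (z : C).

Definition star_term a n : C := a.2 ^+ (q ^ n) / f (Lfac F n) ^+ a.1.

(** Depth recursion on the list of pairs (s_j, z_j): the outer index is below [n], and [i.+1]
    encodes the weak inequality between consecutive indices. *)
Fixpoint star_sum l n : C :=
  if l is a :: l' then \sum_(i < n) star_term a i * star_sum l' i.+1 else 1.

Lemma star_sum_cons a l n :
  star_sum (a :: l) n = \sum_(i < n) star_term a i * star_sum l i.+1.
Proof. by []. Qed.

Definition ffun_cons (r N : nat) (p : 'I_N * {ffun 'I_r -> 'I_N}) : {ffun 'I_r.+1 -> 'I_N} :=
  [ffun j => oapp p.2 p.1 (unlift ord0 j)].

Definition ffun_uncons (r N : nat) (i : {ffun 'I_r.+1 -> 'I_N}) :=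
  (i ord0, [ffun j => i (lift ord0 j)]).

Lemma ffun_consK r N : cancel (@ffun_cons r N) (@ffun_uncons r N).
Proof.
case=> x i; rewrite /ffun_uncons ffunE unlift_none; congr (_, _).
by apply/ffunP => j; rewrite !ffunE liftK.
Qed.

Lemma ffun_unconsK r N : cancel (@ffun_uncons r N) (@ffun_cons r N).
Proof.
move=> i; apply/ffunP => j; rewrite ffunE /=.
by case: unliftP => [b ->|->] /=; rewrite ?ffunE.
Qed.

(** The type bound [N] is kept apart from the bound [n] on the values: removing the first index
    changes the latter while the indices stay in ['I_N]. *)
Lemma star_sum_ffun r (s : 'I_r -> nat) (z : 'I_r -> C) N n : (n <= N)%N ->
  \sum_(i : {ffun 'I_r -> 'I_N}
        | [forall a : 'I_r, forall b : 'I_r, (a <= b)%N ==> (i b <= i a)%N]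
          && [forall a, (i a < n)%N])
     \prod_(j < r) star_term (s j, z j) (i j)
  = star_sum [seq (s j, z j) | j <- enum 'I_r] n.
Proof.
elim: r s z n => [|r IHr] s z n nN.
  rewrite enum_ord0 /= (big_pred1 (@ffun0 _ (fun=> 'I_N) (card_ord 0))) ?big_ord0 // => i /=.
  transitivity true; last by apply/esym/eqP/ffunP => -[].
  by apply/andP; split; apply/forallP => -[].
rewrite (reindex (@ffun_cons r N)) /=; last first.
  by exists (@ffun_uncons r N) => ? _; [apply: ffun_consK | apply: ffun_unconsK].
pose mono (i : {ffun 'I_r -> 'I_N}) :=
  [forall a : 'I_r, forall b : 'I_r, (a <= b)%N ==> (i b <= i a)%N].
(* Split off the first index x: a tuple is nonincreasing exactly when its tail is, with all entries
   of the tail below x + 1. *)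
transitivity (\sum_(x < N | (x < n)%N)
    \sum_(i : {ffun 'I_r -> 'I_N} | mono i && [forall a, (i a < x.+1)%N])
       star_term (s ord0, z ord0) x *
       \prod_(j < r) star_term (s (lift ord0 j), z (lift ord0 j)) (i j)).
  rewrite pair_big_dep; apply: eq_big => [[x i]|[x i] _] /=; last first.
    rewrite big_ord_recl ffunE unlift_none; congr (_ * _).
    by apply: eq_bigr => j _; rewrite ffunE liftK.
  apply/andP/and3P => [[/forallP m /forallP lt]|[xn /forallP m /forallP lt]].
    split; first by have := lt ord0; rewrite ffunE unlift_none.
      apply/forallP => a; apply/forallP => b; apply/implyP => ab.
      have /forallP/(_ (lift ord0 b)) := m (lift ord0 a).
      by rewrite !ffunE !liftK => /implyP; exact.
    apply/forallP => a; have /forallP/(_ (lift ord0 a)) := m ord0.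
    by rewrite !ffunE liftK unlift_none => /implyP; exact.
  split; apply/forallP => a.
    apply/forallP => b; apply/implyP; rewrite !ffunE.
    case: unliftP => [b' ->|->]; case: unliftP => [a' ->|->] //= ab.
      by have /forallP/(_ b')/implyP h := m a'; exact: h ab.
    exact: lt.
  rewrite ffunE; case: unliftP => [a' _|_] //=.
  by apply: leq_trans xn; apply: lt.
rewrite enum_ordSl map_cons -map_comp star_sum_cons.
set l := map _ _; pose E x := star_term (s ord0, z ord0) x * star_sum l x.+1.
rewrite [RHS](big_ord_widen N E nN); apply: eq_bigr => x xn.
by rewrite -mulr_sumr (IHr (s \o lift ord0) (z \o lift ord0)) ?(leq_trans xn).
Qed.

Lemma Listar_partialE r (s : 'I_r -> nat) (z : 'I_r -> C) :
  Listar_partial f s z = star_sum [seq (s j, z j) | j <- enum 'I_r].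
Proof.
apply: funext => n; rewrite -(star_sum_ffun _ _ (leqnn n)); apply: eq_bigl => i.
by rewrite andbC; case: forallP => // -[] a.
Qed.

Let const : {rmorphism F -> C} := f \o @FracField.tofrac {poly F} \o polyC.

Lemma star_termD s x y n :
  star_term (s, x + y) n = star_term (s, x) n + star_term (s, y) n.
Proof. by rewrite /star_term /= (exprDq const) mulrDl. Qed.

Lemma star_sumD s x y l n :
  star_sum ((s, x + y) :: l) n = star_sum ((s, x) :: l) n + star_sum ((s, y) :: l) n.
Proof.
by rewrite !star_sum_cons -big_split; apply: eq_bigr => i _; rewrite star_termD mulrDl.
Qed.

Lemma constant_frobenius (c : F) n :
  f (FracField.tofrac c%:P) ^+ (q ^ n) = f (FracField.tofrac c%:P).
Proof.
rewrite -!rmorphXn /=; congr (f (FracField.tofrac _%:P)).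
by elim: n => [|n IHn]; rewrite ?expr1 // expnSr exprM IHn expf_card.
Qed.

Lemma star_sumMr s z (c : F) l n :
  star_sum ((s, f (FracField.tofrac c%:P) * z) :: l) n =
  f (FracField.tofrac c%:P) * star_sum ((s, z) :: l) n.
Proof.
rewrite !star_sum_cons mulr_sumr; apply: eq_bigr => i _.
by rewrite /star_term /= exprMn constant_frobenius !mulrA.
Qed.

(** When two indices coincide, weights add and arguments multiply; this is the source of the terms
    of smaller depth. *)
Lemma star_termM s1 s2 z1 z2 n :
  star_term (s1, z1) n * star_term (s2, z2) n = star_term ((s1 + s2)%N, z1 * z2) n.
Proof. by rewrite /star_term /= exprMn exprD invfM mulrACA. Qed.

(* Binomial expansion of [(T - T ^+ (q ^ i)) ^+ s], each power of [T ^+ (q ^ i)]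
   being absorbed in the first argument. *)
Lemma star_sum_binomial s s' z l n :
  \sum_(j < s.+1) (T ^+ (s - j) * star_sum ((s', (- T) ^+ j * z) :: l) n) *+ 'C(s, j)
  = \sum_(i < n) (T - T ^+ (q ^ i)) ^+ s * (star_term (s', z) i * star_sum l i.+1).
Proof.
under eq_bigr do rewrite star_sum_cons mulr_sumr -sumrMnl.
rewrite exchange_big; apply: eq_bigr => i _.
(* The sign passes inside the power by additivity of Frobenius, in characteristic 2 as well. *)
have -> : T - T ^+ (q ^ i) = T + (- T) ^+ (q ^ i).
  have q0 : (q == 0)%N = false by rewrite gtn_eqF // (ltn_trans _ (finNzRing_gt1 F)).
  by rewrite -[- T]sub0r (exprBq const) expr0n expn_eq0 q0 sub0r.
rewrite exprDn mulr_suml; apply: eq_bigr => j _.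
rewrite mulrnAl -!mulrA; congr (_ * _ *+ _); rewrite /star_term /= exprMn.
by rewrite -!mulrA -!exprM mulnC.
Qed.

Lemma LfacS n : Lfac F n.+1 = Lfac F n * (theta F - theta F ^+ (q ^ n.+1)).
Proof. by rewrite /Lfac big_nat_recr. Qed.

Hypothesis T_transcendental : forall n, (0 < n)%N -> T - T ^+ (q ^ n) != 0.

(** The term i = 0 vanishes because T^(q^0) = T and s > 0. In the others the factor cancels against
    the last one of L_i, and z^(q^(i+1)) = (z^q)^(q^i). *)
Lemma star_sum_shift s z (X : nat -> C) n : (0 < s)%N ->
  \sum_(i < n.+1) (T - T ^+ (q ^ i)) ^+ s * (star_term (s, z) i * X i)
  = \sum_(i < n) star_term (s, z ^+ q) i * X i.+1.
Proof.
move=> s0; rewrite big_ord_recl expr1 subrr expr0n eqn0Ngt s0 mul0r add0r.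
apply: eq_bigr => i _; rewrite !lift0 mulrA; congr (_ * _).
rewrite /star_term /= LfacS rmorphM rmorphB rmorphXn /= exprMn invfM.
rewrite -exprM -expnS; set D := T - _; have D0 : D ^+ s != 0 by rewrite expf_neq0 ?T_transcendental.
by rewrite mulrC -!mulrA mulVf // mulr1.
Qed.

Lemma star_sum1_frobenius s z n : (0 < s)%N ->
  \sum_(j < s.+1) (T ^+ (s - j) * star_sum [:: (s, (- T) ^+ j * z)] n.+1) *+ 'C(s, j)
  = star_sum [:: (s, z ^+ q)] n.
Proof.
by move=> s0; rewrite star_sum_binomial (star_sum_shift _ (fun i => star_sum [::] i.+1)).
Qed.

(** After the shift the inner sum runs one index too far. The surplus term, shifted back, has equal
    first two indices, and [star_termM] merges them. *)
Lemma star_sum2_frobenius s z s' z' l n : (0 < s)%N ->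
  \sum_(j < s.+1)
     (T ^+ (s - j) * star_sum ((s, (- T) ^+ j * z) :: (s', z') :: l) n.+1) *+ 'C(s, j)
  = star_sum ((s, z ^+ q) :: (s', z') :: l) n +
    \sum_(j < s.+1)
       (T ^+ (s - j) * star_sum (((s + s')%N, (- T) ^+ j * (z * z')) :: l) n.+1)
       *+ 'C(s, j).
Proof.
move=> s0; rewrite !star_sum_binomial (star_sum_shift _ (fun i => star_sum (_ :: _) i.+1)) //.
under eq_bigr do rewrite star_sum_cons big_ord_recr mulrDr.
rewrite big_split /=; congr (_ + _).
rewrite -(star_sum_shift z (fun i => star_term (s', z') i * star_sum l i.+1) n s0).
by apply: eq_bigr => i _; rewrite -star_termM !mulrA.
Qed.

End StarSums.

(** * Convergence and functional equations *)

Section StarSeries.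
Variables (R : realType) (F : finFieldType) (C : fieldType) (abs : C -> R).
Variable f : {rmorphism {fraction {poly F}} -> C}.
Local Notation q := #|F|.
Local Notation T := (f (theta F)).
Hypotheses (absP : is_abs abs) (complete : abs_complete abs) (absT : abs T = q%:R).
Implicit Types (a : nat * C) (l : seq (nat * C)) (z : C).

Let q_gt1 : (1 < q)%N := finNzRing_gt1 F.
Let qR_gt1 : 1 < q%:R :> R. Proof. by rewrite ltr1n. Qed.
Let qR_gt0 : 0 < q%:R :> R. Proof. exact: lt_trans ltr01 qR_gt1. Qed.

Definition radius : R := q%:R `^ (q%:R / (q - 1)%:R).

Lemma radius_gt0 : 0 < radius. Proof. exact: powR_gt0. Qed.

Lemma radiusX s : q%:R `^ ((s * q)%:R / (q - 1)%:R) = radius ^+ s.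
Proof.
rewrite /radius -powR_mulrn ?powR_ge0 // -powRrM natrM; congr (_ `^ _).
by rewrite -mulrA mulrC.
Qed.

(** This relation makes |L_n| = radius^(q^n - 1) propagate from n to n + 1. *)
Lemma radiusXq : radius ^+ q = radius * q%:R ^+ q.
Proof.
have q1 : (q - 1)%:R != 0 :> R by rewrite pnatr_eq0 -lt0n subn_gt0.
have r1 : radius ^+ (q - 1) = q%:R ^+ q.
  by rewrite -powR_mulrn ?powR_ge0 // -powRrM divfK // powR_mulrn ?ltW.
by rewrite -r1 -exprS subn1 prednK // (ltn_trans _ q_gt1).
Qed.

(** The strict inequality leaves room in the disc of weight s for the multipliers T^j with j <=
    s. *)
Lemma q_lt_radius : q%:R < radius.
Proof.
rewrite ltNge; apply/negP => rq; have : radius ^+ q < radius * q%:R ^+ q; last first.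
  by rewrite -radiusXq ltxx.
rewrite -{1}(ltn_predK q_gt1) exprS ltr_pM2l ?radius_gt0 //.
apply: (@le_lt_trans _ _ (q%:R ^+ q.-1)); first by rewrite lerXn2r // nnegrE ltW ?radius_gt0.
by rewrite ltr_eXn2l // prednK // (ltn_trans _ q_gt1).
Qed.

Lemma abs_thetaB n : (0 < n)%N -> abs (T - T ^+ (q ^ n)) = q%:R ^+ (q ^ n).
Proof.
move=> n0; rewrite absD_eq // absN // absX // absT // -{1}[q%:R]expr1.
by rewrite ltr_eXn2l // -{1}(expn0 q) ltn_exp2l.
Qed.

Lemma theta_transcendental n : (0 < n)%N -> T - T ^+ (q ^ n) != 0.
Proof. by move=> n0; rewrite -(abs_gt0 absP) abs_thetaB // exprn_gt0. Qed.

Lemma abs_Lfac n : abs (f (Lfac F n)) * radius = radius ^+ (q ^ n).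
Proof.
elim: n => [|n IHn]; first by rewrite /Lfac big_geq // rmorph1 abs1 // mul1r.
rewrite LfacS rmorphM rmorphB rmorphXn /= absM // abs_thetaB //.
by rewrite mulrAC IHn [in RHS]expnS [in RHS]exprM radiusXq exprMn -exprM -expnS.
Qed.

(** Terms are therefore bounded on the closed disc and decay like rho^(q^n) on the open one, with
    rho < 1. *)
Lemma abs_star_term a n :
  abs (star_term f a n) = (abs a.2 / radius ^+ a.1) ^+ (q ^ n) * radius ^+ a.1.
Proof.
have r0 : radius != 0 by rewrite gt_eqF ?radius_gt0.
have -> : abs (star_term f a n) = abs a.2 ^+ (q ^ n) / abs (f (Lfac F n)) ^+ a.1.
  by rewrite /star_term absM // absX // absV // absX.
have -> : abs (f (Lfac F n)) = radius ^+ (q ^ n) / radius by rewrite -abs_Lfac mulfK.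
rewrite exprMn exprVn [in RHS]expr_div_n -[in RHS]exprM [in RHS]mulnC exprM invfM invrK.
by rewrite mulrA.
Qed.

Definition in_closed_disc a := abs a.2 <= radius ^+ a.1.
Definition in_open_disc a := abs a.2 < radius ^+ a.1.

Lemma star_term_le a n : in_closed_disc a -> abs (star_term f a n) <= radius ^+ a.1.
Proof.
have r0 := exprn_gt0 a.1 radius_gt0.
move=> da; rewrite abs_star_term ler_piMl ?(ltW r0) //.
by rewrite exprn_ile1 ?divr_ge0 ?(abs_ge0 absP) ?(ltW r0) // ler_pdivrMr // mul1r.
Qed.

Lemma star_sum_bounded l : (forall a, a \in l -> in_closed_disc a) ->
  exists2 M, 0 <= M & forall n, abs (star_sum f l n) <= M.
Proof.
elim: l => [|a l IHl] dl; first by exists 1 => // n; rewrite /= abs1.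
have [|M M0 hM] := IHl; first by move=> b bl; apply: dl; rewrite inE bl orbT.
have r0 := ltW (exprn_gt0 a.1 radius_gt0).
exists (radius ^+ a.1 * M) => [|n]; first by rewrite mulr_ge0.
rewrite star_sum_cons; apply: abs_sum_le => // [|i _]; first by rewrite mulr_ge0.
rewrite absM // ler_pM ?abs_ge0 // star_term_le //.
by apply: dl; rewrite mem_head.
Qed.

(* [D_infty] for lists of pairs (s_i, z_i), see [D_inftyP]. *)
Definition in_domain l :=
  if l is a :: l' then in_open_disc a /\ (forall b, b \in l' -> in_closed_disc b)
  else True.

Lemma star_sum_cvg l : in_domain l -> exists x, abs_cvg abs (star_sum f l) x.
Proof.
case: l => [_|a l [da dl]]; first by exists 1; apply: abs_cvg_cst.
have [M M0 hM] := star_sum_bounded dl; have r0 := exprn_gt0 a.1 radius_gt0.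
have rho0 : 0 <= abs a.2 / radius ^+ a.1 by rewrite divr_ge0 ?(abs_ge0 absP) ?(ltW r0).
have rho1 : abs a.2 / radius ^+ a.1 < 1 by rewrite ltr_pdivrMr // mul1r.
apply: (@abs_cvg_series _ _ _ absP (fun i => star_term f a i * star_sum f l i.+1)
  (radius ^+ a.1 * M) (abs a.2 / radius ^+ a.1)) => //.
- by rewrite rho0.
- by rewrite mulr_ge0 // ltW.
move=> n; rewrite absM // abs_star_term -mulrA [leRHS]mulrC.
move: (_ / _) rho0 rho1 => rho rho0 rho1.
rewrite ler_pM ?exprn_ge0 ?mulr_ge0 ?(abs_ge0 absP) ?(ltW r0) //.
  (* The decay rho^(q^n) is compared with the geometric rho^n. *)
  by rewrite ler_wiXn2l ?(ltW rho1) // ltnW // ltn_expl.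
by rewrite ler_pM2l.
Qed.

(** Uses the same default as [Listar], so that the two agree even without convergence. *)
Definition star_Li l : C := xget 0 [set x | abs_cvg abs (star_sum f l) x].

Lemma star_Li_eq l x : abs_cvg abs (star_sum f l) x -> star_Li l = x.
Proof.
move=> lx; have h : abs_cvg abs (star_sum f l) (star_Li l).
  by apply: (@xgetPex _ 0 [set y | abs_cvg abs (star_sum f l) y]); exists x.
exact: (abs_cvg_unique absP h lx).
Qed.

Lemma star_LiP l : in_domain l -> abs_cvg abs (star_sum f l) (star_Li l).
Proof. by move=> /star_sum_cvg[x xP]; rewrite (star_Li_eq xP). Qed.

Lemma ListarE r (s : 'I_r -> nat) (z : 'I_r -> C) :
  Listar abs f s z = star_Li [seq (s j, z j) | j <- enum 'I_r].
Proof. by rewrite /Listar Listar_partialE. Qed.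

Lemma star_LiD s x y l : in_domain ((s, x) :: l) -> in_domain ((s, y) :: l) ->
  star_Li ((s, x + y) :: l) = star_Li ((s, x) :: l) + star_Li ((s, y) :: l).
Proof.
move=> dx dy; apply: star_Li_eq.
have -> : star_sum f ((s, x + y) :: l) =
    fun n => star_sum f ((s, x) :: l) n + star_sum f ((s, y) :: l) n.
  by apply: funext => n; rewrite star_sumD.
exact: (abs_cvgD absP (star_LiP dx) (star_LiP dy)).
Qed.

Lemma star_LiMr s z (c : F) l : in_domain ((s, z) :: l) ->
  star_Li ((s, f (FracField.tofrac c%:P) * z) :: l) =
  f (FracField.tofrac c%:P) * star_Li ((s, z) :: l).
Proof.
move=> dz; apply: star_Li_eq.
have -> : star_sum f ((s, f (FracField.tofrac c%:P) * z) :: l) =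
    fun n => f (FracField.tofrac c%:P) * star_sum f ((s, z) :: l) n.
  by apply: funext => n; rewrite star_sumMr.
exact: (abs_cvgZ absP _ (star_LiP dz)).
Qed.

(** |T|^j <= q^s < radius^s. Taking s' = 0 and z' = 1 gives the case without merged argument. *)
Lemma binomial_disc s s' j z z' : (0 < s)%N -> (j <= s)%N -> abs z <= 1 ->
  abs z' <= radius ^+ s' -> in_open_disc ((s + s')%N, (- T) ^+ j * (z * z')).
Proof.
move=> s0 js z1 z'1; rewrite /in_open_disc /= !(absM absP) (absX absP) (absN absP) absT.
have r0 := exprn_gt0 s' radius_gt0.
rewrite exprD (@le_lt_trans _ _ (q%:R ^+ s * radius ^+ s')) //.
  apply: ler_pM; rewrite ?mulr_ge0 ?exprn_ge0 ?(abs_ge0 absP) ?(ltW qR_gt0) //.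
    by rewrite ler_eXn2l.
  by rewrite -[leRHS]mul1r ler_pM ?(abs_ge0 absP).
by rewrite ltr_pM2r // ltrXn2r ?nnegrE ?q_lt_radius // ?ltW ?radius_gt0 // -lt0n.
Qed.

Lemma binomial_disc1 s j z : (0 < s)%N -> (j <= s)%N -> abs z <= 1 ->
  in_open_disc (s, (- T) ^+ j * z).
Proof.
move=> s0 js z1; have := @binomial_disc s 0 j z 1 s0 js z1.
by rewrite addn0 mulr1; apply; rewrite abs1.
Qed.

Lemma unit_disc s z : (0 < s)%N -> abs z <= 1 -> in_open_disc (s, z).
Proof. by move=> s0 z1; have := @binomial_disc1 s 0 z s0 (leq0n s) z1; rewrite mul1r. Qed.

Lemma abs_cvg_binomial s (u : nat -> nat -> C) (x : nat -> C) :
  (forall j, (j <= s)%N -> abs_cvg abs (u j) (x j)) ->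
  abs_cvg abs (fun n => \sum_(j < s.+1) (T ^+ (s - j) * u j n.+1) *+ 'C(s, j))
              (\sum_(j < s.+1) (T ^+ (s - j) * x j) *+ 'C(s, j)).
Proof.
move=> ux; apply: (abs_cvg_sum absP) => j.
have -> : (fun n => (T ^+ (s - j) * u j n.+1) *+ 'C(s, j)) =
    fun n => 'C(s, j)%:R * (T ^+ (s - j) * u j n.+1).
  by apply: funext => n; rewrite mulr_natl.
have js : (j <= s)%N by rewrite -ltnS.
rewrite -[X in abs_cvg _ _ X]mulr_natl.
exact: (abs_cvgZ absP _ (abs_cvgZ absP _ (abs_cvgS absP (ux j js)))).
Qed.

(** Limit of the identity between partial sums; the offset between [n.+1] and [n] disappears in the
    limit. *)
Lemma star_Li1_frobenius s z : (0 < s)%N -> abs z <= 1 ->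
  star_Li [:: (s, z ^+ q)] =
  \sum_(j < s.+1) (T ^+ (s - j) * star_Li [:: (s, (- T) ^+ j * z)]) *+ 'C(s, j).
Proof.
move=> s0 z1; have dz j : (j <= s)%N -> in_domain [:: (s, (- T) ^+ j * z)].
  by move=> js; split=> //; apply: binomial_disc1.
apply: (abs_cvg_unique absP); last first.
  exact: (@abs_cvg_binomial s (fun j => star_sum f [:: (s, (- T) ^+ j * z)]) _
    (fun j js => star_LiP (dz j js))).
under eq_fun do rewrite (star_sum1_frobenius theta_transcendental) //.
by apply: star_LiP; split=> //; apply: unit_disc => //; apply: absX_le1.
Qed.

Lemma star_Li2_frobenius s z s' z' l : (0 < s)%N -> abs z <= 1 ->
  (forall b, b \in (s', z') :: l -> in_closed_disc b) ->
  \sum_(j < s.+1)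
     (T ^+ (s - j) * star_Li ((s, (- T) ^+ j * z) :: (s', z') :: l)) *+ 'C(s, j)
  = star_Li ((s, z ^+ q) :: (s', z') :: l) +
    \sum_(j < s.+1)
       (T ^+ (s - j) * star_Li (((s + s')%N, (- T) ^+ j * (z * z')) :: l)) *+ 'C(s, j).
Proof.
move=> s0 z1 dl; have dz j : (j <= s)%N -> in_domain ((s, (- T) ^+ j * z) :: (s', z') :: l).
  by move=> js; split=> //; apply: binomial_disc1.
have dzz j : (j <= s)%N -> in_domain (((s + s')%N, (- T) ^+ j * (z * z')) :: l).
  move=> js; split; first by apply: binomial_disc => //; apply: (dl (s', z')); rewrite mem_head.
  by move=> b bl; apply: dl; rewrite inE bl orbT.
apply: (abs_cvg_unique absP).
  exact: (@abs_cvg_binomial s (fun j => star_sum f ((s, (- T) ^+ j * z) :: _ :: l)) _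
    (fun j js => star_LiP (dz j js))).
under eq_fun do rewrite (star_sum2_frobenius theta_transcendental) //.
apply: abs_cvgD => //; last first.
  exact: (@abs_cvg_binomial s (fun j => star_sum f ((_, (- T) ^+ j * (z * z')) :: l)) _
    (fun j js => star_LiP (dzz j js))).
by apply: star_LiP; split=> //; apply: unit_disc => //; apply: absX_le1.
Qed.

End StarSeries.

(** * Vanishing modulo the span *)

Section Continuation.
Variables (R : realType) (F : finFieldType) (v : {poly F}) (C K : fieldType).
Variables (absC : C -> R) (f : {rmorphism {fraction {poly F}} -> C}).
Variables (G : {rmorphism K -> C}) (g : {rmorphism {poly F} -> K}).
Variables (ai av : ultrametric R K).
Local Notation q := #|F|.
Local Notation Li := (star_Li absC f).
Hypotheses (absP : is_abs absC) (complete : abs_complete absC).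
Hypothesis aiG : forall x, absC (G x) = ai x.
Hypothesis fG : forall P, f (FracField.tofrac P) = G (g P).
Hypothesis aiE : forall P, P != 0 -> ai (g P) = q%:R ^+ (size P).-1.
Hypotheses (v_irr : irreducible_poly v) (av_int : forall P, av (g P) <= 1).
Hypothesis av_v : av (g v) < 1.
Hypothesis g_alg : forall x, exists2 p : {poly {poly F}}, p != 0 & root (map_poly g p) x.

Definition embed (a : nat * K) : nat * C := (a.1, G a.2).

Definition positive_weights (l : seq (nat * K)) := forall a, a \in l -> (0 < a.1)%N.
Definition v_integral (l : seq (nat * K)) := forall a, a \in l -> av a.2 <= 1.
Local Notation in_dom l := (in_domain F absC (map embed l)).

(** Stands for the span of the convergent values; [W_conv] is all that is assumed about it. *)
Variable W : linear_subspace G.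
Hypothesis W_conv : forall s z l, positive_weights ((s, z) :: l) ->
  in_dom ((s, z) :: l) -> av z < 1 -> v_integral l -> W (Li (map embed ((s, z) :: l))).

Let aiP := ultrametricP ai.
Let avP := ultrametricP av.

Let g_inj : injective g.
Proof.
apply: raddf_inj => P gP; apply/eqP/negPn/negP => /aiE/eqP.
by rewrite gP abs0 // eq_sym expf_eq0 pnatr_eq0 gtn_eqF ?andbF // (ltn_trans _ (finNzRing_gt1 F)).
Qed.

Let absT : absC (f (theta F)) = q%:R.
Proof. by rewrite fG aiG aiE ?polyX_eq0 // size_polyX expr1. Qed.

Let fT : f (theta F) = G (g 'X). Proof. exact: fG. Qed.

(** Multiply any lift x by an element close to 1 at [v] and of size at most 1 / (|x| + 1) at
    infinity; the added 1 covers x = 0. *)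
Lemma small_lift (t : residue av) :
  exists y, [/\ ai y <= 1, av y <= 1 & red av y = t].
Proof.
have [x x1 xt] := red_surj t; have ax := abs_ge0 aiP x.
have M0 : 0 < (ai x + 1)^-1 by rewrite invr_gt0 ltr_wpDl.
have [e [ei ev e1]] := weak_approximation v_irr av_v aiE M0.
exists (e * x); split; first last.
- rewrite redM // xt -[RHS]mul1r; congr (_ * _); apply/eqP.
  by rewrite -(red1 av) red_eq // abs1.
- exact: (absM_le1 avP).
rewrite (absM aiP) (le_trans (ler_wpM2r ax ei)) // mulrC ler_pdivrMr ?mul1r //.
  by rewrite lerDl.
by rewrite ltr_wpDl.
Qed.

Section Step.
Variables (s : nat) (l : seq (nat * K)).
Hypotheses (s_gt0 : (0 < s)%N) (l_pos : positive_weights l) (l_int : v_integral l).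
Hypothesis l_disc : forall b, b \in map embed l -> in_closed_disc F absC b.
Hypothesis IH : forall l', (size l' <= size l)%N -> l' != [::] ->
  positive_weights l' -> in_dom l' -> v_integral l' -> W (Li (map embed l')).

Let T (y : K) : linear_quotient W := quotient_class W (Li (map embed ((s, y) :: l))).
Let dom (y : K) := in_open_disc F absC (embed (s, y)).

Let dom_le1 y : ai y <= 1 -> dom y.
Proof. by move=> y1; apply: (unit_disc absP absT) => //=; rewrite aiG. Qed.

Let domB y y' : dom y -> dom y' -> dom (y - y').
Proof.
rewrite /dom /in_open_disc /= rmorphB; exact: (absB_lt absP).
Qed.

Let T_D y y' : dom y -> dom y' -> T (y + y') = T y + T y'.
Proof.
by move=> dy dy'; rewrite /T -quotient_classD /= /embed /= rmorphD (star_LiD absP complete absT).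
Qed.

(** By additivity the difference of the two classes is the class at [y - y'], which is small at [v]
    and so falls under [W_conv]. *)
Let T_eq y y' : dom y -> dom y' -> av y <= 1 -> av y' <= 1 -> red av y = red av y' ->
  T y = T y'.
Proof.
move=> dy dy' y1 y'1 /eqP; rewrite red_eq // => yy'.
rewrite -(subrK y' y) T_D ?domB // [T (y - y')](_ : _ = 0) ?add0r //.
apply/quotient_class_eq0/W_conv => //; last by split => //; apply: domB.
by move=> a; rewrite inE => /orP[/eqP ->|/l_pos].
Qed.

Let lift t : K := projT1 (cid (small_lift t)).
Let liftP t : [/\ ai (lift t) <= 1, av (lift t) <= 1 & red av (lift t) = t].
Proof. exact: projT2 (cid (small_lift t)). Qed.

(** The map induced on the residue field. Lifts from the unit disc at infinity lie in the domain for
    every positive weight, even after multiplication by theta^j with j <= s. *)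
Let tau t := T (lift t).

Let tauE y : dom y -> av y <= 1 -> T y = tau (red av y).
Proof.
by move=> dy y1; have [i1 v1 e] := liftP (red av y); apply: T_eq => //; apply: dom_le1.
Qed.

Let tau_additive : zmod_morphism tau.
Proof.
move=> t t'; have [i0 v0 e0] := liftP (t - t'); have [i1 v1 e1] := liftP t.
have [i2 v2 e2] := liftP t'; apply: (addIr (tau t')); rewrite subrK -T_D ?dom_le1 //.
rewrite tauE ?redD ?e0 ?e2 ?subrK //; last exact: (absD_le avP).
by rewrite -[lift t']opprK domB ?dom_le1 ?absN.
Qed.

Let dom_binomial j y : (j <= s)%N -> ai y <= 1 -> dom ((- g 'X) ^+ j * y).
Proof.
move=> js y1; rewrite /dom /embed /= rmorphM rmorphXn rmorphN -fT.
by apply: (binomial_disc1 absP absT) => //; rewrite aiG.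
Qed.

(* The terms of smaller depth in the functional equation are in [W] by [IH]. *)
Let T_frobenius y : ai y <= 1 -> av y <= 1 ->
  T (y ^+ q) = \sum_(j < s.+1) (g 'X ^+ (s - j) *: T ((- g 'X) ^+ j * y)) *+ 'C(s, j).
Proof.
move=> y1 v1; have y1' : absC (G y) <= 1 by rewrite aiG.
have classE (X : nat -> C) :
    quotient_class W (\sum_(j < s.+1) (f (theta F) ^+ (s - j) * X j) *+ 'C(s, j)) =
    \sum_(j < s.+1) (g 'X ^+ (s - j) *: quotient_class W (X j)) *+ 'C(s, j).
  rewrite raddf_sum; apply: eq_bigr => j _.
  by rewrite raddfMn /= fT -rmorphXn quotient_classZ.
have embedE j m (w : K) : embed (m, (- g 'X) ^+ j * w) = (m, (- f (theta F)) ^+ j * G w).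
  by rewrite /embed /= rmorphM rmorphXn rmorphN fT.
rewrite /T; under eq_bigr do rewrite map_cons embedE.
rewrite -(classE (fun j => Li ((s, (- f (theta F)) ^+ j * G y) :: map embed l))).
rewrite map_cons {1}/embed /= rmorphXn; case El: l => [|[s' z'] l'].
  by rewrite (star_Li1_frobenius absP complete absT).
have disc b : b \in (s', G z') :: map embed l' -> in_closed_disc F absC b.
  by move=> bl; apply: l_disc; rewrite El.
rewrite /= {2}/embed /= (star_Li2_frobenius absP complete absT) // quotient_classD.
rewrite (classE (fun j => Li (((s + s')%N, (- f (theta F)) ^+ j * (G y * G z')) ::
  map embed l'))) big1 ?addr0 // => j _.
(* The merged list is exactly as long as [l], one entry shorter than the list treated, so [IH]
   covers it. *)
rewrite [X in _ *: X](_ : _ = 0) ?scaler0 ?mul0rn //; apply/quotient_class_eq0.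
rewrite -rmorphM -embedE -map_cons; have js : (j <= s)%N by rewrite -ltnS.
have z'1 : av z' <= 1 by apply: (l_int (a := (s', z'))); rewrite El mem_head.
apply: IH => //; first by rewrite El.
- move=> a; rewrite inE => /orP[/eqP -> /=|al]; first by rewrite addn_gt0 s_gt0.
  by apply: l_pos; rewrite El inE al orbT.
- rewrite map_cons embedE rmorphM; split; last by move=> b bl; apply: disc; rewrite inE bl orbT.
  by apply: (binomial_disc absP absT) => //; apply: (disc (s', G z')); rewrite mem_head.
move=> a; rewrite inE => /orP[/eqP -> /=|al]; last by apply: l_int; rewrite El inE al orbT.
by rewrite !(absM_le1 avP) ?(absX_le1 avP) // absN.
Qed.

(** The class depends only on the residue of [z], which is periodic under Frobenius since [z] is
    algebraic; the induced map [tau] then vanishes there by the eigenvector lemma. *)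
Lemma continuation_step z : dom z -> av z <= 1 -> W (Li (map embed ((s, z) :: l))).
Proof.
move=> dz z1; apply/quotient_class_eq0; rewrite -/(T z) tauE //.
have [i iE] := residue_constants av_int.
pose tauM := GRing.isZmodMorphism.Build (residue av) (linear_quotient W) tau tau_additive.
pose tau' : {additive residue av -> linear_quotient W} := HB.pack tau tauM.
have [p p0 pz] := g_alg z.
have [m [m0 thm zm]] := residue_periodic v_irr g_inj av_int av_v iE z1 p0 pz.
rewrite -[tau _]/(tau' (red av z)).
apply: (@frobenius_eigenvector_eq0 _ _ _ _ g i (red av (g 'X)) s tau') thm zm => //.
  move=> c x; rewrite -[tau' x]/(T (lift x)) -[LHS]/(tau _).
  have [x1 v1 xE] := liftP x.
  have c1 : ai (g c%:P) <= 1.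
    have [->|c0] := eqVneq c 0; first by rewrite !rmorph0 abs0.
    by rewrite aiE ?polyC_eq0 // size_polyC c0.
  rewrite -{1}xE iE -redM // -tauE ?dom_le1 ?(absM_le1 aiP) ?(absM_le1 avP) //.
  rewrite /T /= /embed /= rmorphM -fG star_LiMr //.
    by rewrite fG quotient_classZ.
  by split => //; apply: dom_le1.
move=> x; rewrite -[LHS]/(tau _); have [x1 v1 xE] := liftP x.
rewrite -{1}xE -redX // -tauE; last exact: (absX_le1 avP); last first.
  by apply: dom_le1; apply: (absX_le1 aiP).
rewrite T_frobenius //; apply: eq_bigr => j _; congr ((_ *: _) *+ _).
have vX : av (- g 'X) <= 1 by rewrite (absN avP).
have redN : red av (- g 'X) = - red av (g 'X).
  by rewrite -(sub0r (g 'X)) redB ?(abs0 avP) // red0 sub0r.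
rewrite -[RHS]/(tau _) tauE ?redM ?redX ?(absX_le1 avP) // ?xE.
- by rewrite redN.
- by apply: dom_binomial; rewrite // -ltnS.
by rewrite (absM_le1 avP) ?(absX_le1 avP).
Qed.

End Step.

Lemma continuation l : l != [::] -> positive_weights l -> in_dom l -> v_integral l ->
  W (Li (map embed l)).
Proof.
have [n] := ubnP (size l); elim: n l => // n IHn [//|[s z] l] sl _ pos [dz dl] int.
apply: continuation_step => //.
- by apply: (pos (s, z)); rewrite mem_head.
- by move=> a al; apply: pos; rewrite inE al orbT.
- by move=> a al; apply: int; rewrite inE al orbT.
- by move=> l' l'l; apply: IHn; rewrite (leq_ltn_trans l'l).
by apply: (int (s, z)); rewrite mem_head.
Qed.

End Continuation.

(** * Comparison of the two spans *)

Section PolynomialValuations.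
Variables (R : realType) (F : finFieldType).
Implicit Types a v : {poly F}.

(** The chosen representative is a pair (a d, d) with d unknown, so each valuation has to be
    computed by cancelling d. *)
Lemma repr_tofrac a : exists2 d : {poly F}, d != 0 &
  forall h : {poly F} -> R, frac_ext h (FracField.tofrac a) = h (a * d) / h d.
Proof.
exists (frac (repr (FracField.tofrac a))).2; first exact: denom_ratioP.
move=> h; rewrite /frac_ext; congr (h _ / _).
have /eqP := reprK (FracField.tofrac a); unlock FracField.tofrac.
by rewrite FracField.equivf_def !numden_Ratio ?oner_neq0 // mulr1 mulrC => /eqP ->.
Qed.

Lemma abs_infty_tofrac a : a != 0 ->
  abs_infty R (FracField.tofrac a) = #|F|%:R ^+ (size a).-1.
Proof.
move=> a0; have [d d0 dE] := repr_tofrac a; rewrite /abs_infty dE.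
rewrite mulf_eq0 (negPf a0) (negPf d0) /= size_mul //.
have q0 : #|F|%:R != 0 :> R by rewrite pnatr_eq0 gtn_eqF // (ltn_trans _ (finNzRing_gt1 F)).
have [sa sd] : (0 < size a)%N /\ (0 < size d)%N by rewrite !size_poly_gt0.
rewrite -(prednK sa) -(prednK sd) addSn addnS /= exprD mulfK //.
by rewrite expf_neq0.
Qed.

Lemma ord_at_ge v a i : (1 < size v)%N -> a != 0 -> (v ^+ i %| a) -> (i <= ord_at v a)%N.
Proof.
(* This puts [i] within the finite range of the maximum defining [ord_at]. *)
move=> v1 a0 va; have ia : (i < size a)%N.
  apply: leq_trans (dvdp_leq a0 va).
  rewrite -(prednK (_ : 0 < size (v ^+ i))%N) ?size_exp; last first.
    by rewrite size_poly_gt0 expf_neq0 // -size_poly_gt0 (ltn_trans _ v1).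
  by rewrite ltnS leq_pmull // -ltnS prednK // (ltn_trans _ v1).
by rewrite /ord_at; apply: (@leq_bigmax_cond _ _ _ (Ordinal ia)).
Qed.

Lemma ord_at_dvd v a : v ^+ ord_at v a %| a.
Proof.
rewrite /ord_at; elim/big_ind: _ => [|m n|//]; first by rewrite dvd1p.
by rewrite /maxn; case: ifP.
Qed.

Section AbsAt.
Variable v : {poly F}.
Hypothesis v_gt1 : (1 < size v)%N.
Local Notation c := (#|F|%:R ^- (size v).-1 : R).

Let c_gt0 : 0 < c.
Proof. by rewrite invr_gt0 exprn_gt0 // ltr0n (ltn_trans _ (finNzRing_gt1 F)). Qed.

Let c_lt1 : c < 1.
Proof.
rewrite invf_lt1 ?exprn_egt1 ?ltr1n ?finNzRing_gt1 //.
  by rewrite -lt0n -ltnS prednK // (ltn_trans _ v_gt1).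
by rewrite exprn_gt0 // ltr0n (ltn_trans _ (finNzRing_gt1 F)).
Qed.

Lemma abs_at_tofrac_le1 a : abs_at R v (FracField.tofrac a) <= 1.
Proof.
have [d d0 dE] := repr_tofrac a; rewrite /abs_at dE mulf_eq0 (negPf d0) orbF.
case: eqVneq => [|a0]; first by rewrite mul0r.
rewrite ler_pdivrMr ?exprn_gt0 // mul1r ler_wiXn2l ?ltW //.
by rewrite ord_at_ge ?mulf_neq0 // dvdp_mull // ord_at_dvd.
Qed.

(** One more factor [v] divides v d than d, and the base of the powers is below 1. *)
Lemma abs_at_tofrac_lt1 : abs_at R v (FracField.tofrac v) < 1.
Proof.
have v0 : v != 0 by rewrite -size_poly_gt0 (ltn_trans _ v_gt1).
have [d d0 dE] := repr_tofrac v; rewrite /abs_at dE mulf_eq0 (negPf d0) (negPf v0) /=.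
rewrite ltr_pdivrMr ?exprn_gt0 // mul1r ltr_iXn2l //.
by apply: ord_at_ge; rewrite ?mulf_neq0 // exprS dvdp_mul // ord_at_dvd.
Qed.

End AbsAt.
End PolynomialValuations.

Lemma is_abs_comp (R : realType) (K L : fieldType) (abs : L -> R) (h : {rmorphism K -> L}) :
  is_abs abs -> is_abs (abs \o h).
Proof.
move=> absP; split=> [x|x|x y|x y] /=.
- exact: abs_ge0.
- by split=> [/eqP|->]; rewrite ?rmorph0 ?abs0 // abs_eq0 // fmorph_eq0 => /eqP.
- by rewrite rmorphM absM.
- by rewrite rmorphD abs_max.
Qed.

(** * Spans as linear subspaces *)

Section Span.
Variables (K C : fieldType) (h : {rmorphism K -> C}) (S : set C).

Lemma span_over0 : span_over h S 0.
Proof. by exists 0, (fun=> 0), (fun=> 0); rewrite big_ord0; split=> // -[]. Qed.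

Lemma span_overZ a x : span_over h S x -> span_over h S (h a * x).
Proof.
move=> [n [c [y [Sy ->]]]]; exists n, (fun j => a * c j), y; split=> //.
by rewrite mulr_sumr; apply: eq_bigr => j _; rewrite rmorphM mulrA.
Qed.

Lemma span_overD x y : span_over h S x -> span_over h S y -> span_over h S (x + y).
Proof.
move=> [m [c [z [Sz ->]]]] [n [d [w [Sw ->]]]].
pose glue T (a : 'I_m -> T) (b : 'I_n -> T) j :=
  match fintype.split j with inl i => a i | inr i => b i end.
exists (m + n)%N, (glue _ c d), (glue _ z w); split.
  by move=> j; rewrite /glue; case: splitP.
rewrite big_split_ord; congr (_ + _); apply: eq_bigr => j _; rewrite /glue.
  by rewrite (unsplitK (inl j)).
by rewrite (unsplitK (inr j)).
Qed.

Lemma span_over_gen x : S x -> span_over h S x.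
Proof.
move=> Sx; exists 1%N, (fun=> 1), (fun=> x); split=> //.
by rewrite big_ord1 rmorph1 mul1r.
Qed.

Definition span_subspace := Subspace span_over0 span_overD span_overZ.

Lemma span_over_min (W : linear_subspace h) : (forall x, S x -> W x) ->
  forall x, span_over h S x -> W x.
Proof.
move=> SW x [n [c [y [Sy ->]]]]; elim/big_ind: _ => [|u w|j _].
- exact: subspace0.
- exact: subspaceD.
by apply/subspaceZ/SW.
Qed.

End Span.

Lemma D_inftyP (R : realType) (F : finFieldType) (C : fieldType) (abs : C -> R) r
    (s : 'I_r -> nat) (z : 'I_r -> C) :
  D_infty F abs s z <-> in_domain F abs [seq (s j, z j) | j <- enum 'I_r].
Proof.
case: r s z => [|r] s z; first by rewrite enum_ord0; split=> // _ [].
rewrite enum_ordSl map_cons -map_comp; split=> [h|[h0 hS] i /=].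
  split; first by have := h ord0; rewrite /= radiusX.
  by move=> b /mapP[j _ ->]; have := h (lift ord0 j); rewrite /= radiusX.
rewrite radiusX; case: (unliftP ord0 i) => [j ->|-> //].
by apply: (hS (s (lift ord0 j), z (lift ord0 j))); apply/mapP; exists j; rewrite ?mem_enum.
Qed.

Lemma enum_nth_fst (T1 T2 : Type) (d : T1 * T2) (l : seq (T1 * T2)) :
  [seq ((nth d l j).1, (nth d l j).2) | j : 'I__ <- enum 'I_(size l)] = l.
Proof.
rewrite -[RHS](mkseq_nth d) /mkseq -val_enum_ord -map_comp.
by apply: eq_map => j /=; case: (nth d l j).
Qed.

Theorem theorem4p3 (R : realType) (F : finFieldType) (v : {poly F})
    (v_monic : v \is monic) (v_irr : irreducible_poly v)
    (Cinf : fieldType) (absinf : Cinf -> R)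
    (finf : {rmorphism {fraction {poly F}} -> Cinf})
    (Cinf_spec : is_completed_algebraic_closure (@abs_infty R F) absinf finf)
    (Cv : fieldType) (absv : Cv -> R)
    (fv : {rmorphism {fraction {poly F}} -> Cv})
    (Cv_spec : is_completed_algebraic_closure (@abs_at R F v) absv fv)
    (kbar : closedFieldType)
    (fbar : {rmorphism {fraction {poly F}} -> kbar})
    (kbar_spec : is_algebraic_closure fbar)
    (ginf : {rmorphism kbar -> Cinf})
    (ginf_over : forall x, ginf (fbar x) = finf x)
    (gv : {rmorphism kbar -> Cv})
    (gv_over : forall x, gv (fbar x) = fv x) :
  L_conv absinf absv finf ginf gv = L_def absinf absv finf ginf gv.
Proof.
(* Condenses the tower of completions and algebraic closures to an ultrametric, complete absolute
   value extending that of the base. *)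
have extends (k L : fieldType) (absk : k -> R) (absL : L -> R) (f : {rmorphism k -> L}) :
    is_completed_algebraic_closure absk absL f ->
    [/\ is_abs absL, abs_complete absL & forall x, absL (f x) = absk x].
  move=> [K' [absK [f1 [Kbar [absKbar [f2 [f3]]]]]]].
  case=> -[_ _ f1E _] _ [_ f2E] [absP complete f3E _] fE.
  by split=> // x; rewrite fE f3E f2E f1E.
have [infP inf_complete infE] := extends _ _ _ _ _ Cinf_spec.
have [vP _ vE] := extends _ _ _ _ _ Cv_spec.
have [v_gt1 _] := v_irr.
(* Both absolute values are pulled back to [kbar], where they can be compared by weak
   approximation. *)
pose ai := Ultrametric (is_abs_comp ginf infP); pose av := Ultrametric (is_abs_comp gv vP).
pose g : {rmorphism {poly F} -> kbar} := fbar \o @FracField.tofrac {poly F}.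
have aiE P : P != 0 -> ai (g P) = #|F|%:R ^+ (size P).-1.
  by move=> P0; rewrite /= ginf_over infE abs_infty_tofrac.
have av_int P : av (g P) <= 1 by rewrite /= gv_over vE abs_at_tofrac_le1.
have av_v : av (g v) < 1 by rewrite /= gv_over vE abs_at_tofrac_lt1.
have g_alg x : exists2 p : {poly {poly F}}, p != 0 & root (map_poly g p) x.
  have [p p0 px] := kbar_spec x; have [d [r [d0 rE]]] := clear_denominators p.
  have d0' : FracField.tofrac d != 0 by rewrite tofrac_eq0.
  exists r; first by
    apply: contraNneq p0 => r0; move/eqP: rE; rewrite r0 rmorph0 eq_sym scaler_eq0 (negPf d0').
  by rewrite /g map_poly_comp /= rE map_polyZ rootZ // fmorph_eq0.
pose S := (fun y : Cinf => y = 1 \/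
       exists (r : nat) (s : 'I_r -> nat) (u : 'I_r -> kbar),
         [/\ (0 < r)%N, forall i, (0 < s i)%N, D_conv_kbar F absinf absv ginf gv s u &
             y = Listar absinf finf s (ginf \o u)]).
have W_conv s z l : positive_weights ((s, z) :: l) ->
    in_domain F absinf (map (embed ginf) ((s, z) :: l)) -> av z < 1 -> v_integral av l ->
    span_subspace ginf S (star_Li absinf finf (map (embed ginf) ((s, z) :: l))).
  move=> pos dom z1 int; apply: span_over_gen; right.
  set l' := _ :: _ in pos dom *.
  (* Only a default for [nth]: the indices below stay within the list. *)
  pose d : nat * kbar := (0%N, 0).
  have lE : [seq ((nth d l' j).1, ginf (nth d l' j).2) | j : 'I__ <- enum 'I_(size l')]
      = map (embed ginf) l'.
    by rewrite -[RHS](congr1 (map (embed ginf)) (enum_nth_fst d l')) -[RHS]map_comp.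
  exists (size l'), (fun j => (nth d l' j).1), (fun j => (nth d l' j).2).
  split=> //; last by rewrite ListarE lE.
    by move=> j; apply/pos/mem_nth.
  split; first by apply/D_inftyP; rewrite lE.
  by case=> -[|j] jl //=; apply/int/mem_nth.
apply/seteqP; split=> x.
  (* Easy inclusion: the strict bound on the first coordinate implies the weak one. *)
  apply: (span_over_min (W := span_subspace ginf _)) => y [->|[r [s [u [r0 s0 [ui uv] ->]]]]];
    apply: span_over_gen; [by left | right].
  exists r, s, u; split=> //; split=> // j; have := uv j; case: ifP => // _; exact: ltW.
apply: (span_over_min (W := span_subspace ginf S)) => y [->|[r [s [u [r0 s0 [ui uv] ->]]]]].
  by apply: span_over_gen; left.
rewrite ListarE.
have -> : [seq (s j, (ginf \o u) j) | j <- enum 'I_r] =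
    map (embed ginf) [seq (s j, u j) | j <- enum 'I_r] by rewrite -[RHS]map_comp.
(* Reverse inclusion, with the convergent span as the subspace [W]. *)
apply: (continuation infP inf_complete _ _ aiE v_irr av_int av_v g_alg W_conv) => //.
- by move=> P; rewrite /= ginf_over.
- by rewrite -size_eq0 size_map size_enum_ord -lt0n.
- by move=> a /mapP[j _ ->]; apply: s0.
- by rewrite -map_comp; apply/D_inftyP.
by move=> a /mapP[j _ ->]; apply: uv.
Qed.
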